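(* Every morphism in $\widetilde{\mathbf{Gr}}$ factors as a refinement followed by a free map. This factorisation is unique up to free isomorphism: if $R\to Q\to Y$ and $R\to Q'\to Y$ are two factorisations of the same morphism as a refinement followed by a free map, then there is a free isomorphism $Q\simeq Q'$ compatible with the two factorisations (this isomorphism is in general not unique).
   Context: GRAPHS. A directed graph is a diagram of finite sets $A\xleftarrow{s}I\xrightarrow{p}N\xleftarrow{q}O\xrightarrow{t}A$ (same $A$ at both ends) with $s,t$ injective ($A$ edges, $N$ nodes, $I$ in-flags, $O$ out-flags). Edges not in the image of $t$ are imports; edges not in the image of $s$ are exports. Morphisms are levelwise maps (the same on $A$ at both ends) commuting with the structure maps; a morphism is etale if the two middle squares ($I'\to N'$ over $I\to N$, $O'\to N'$ over $O\to N$) are pullbacks. A directed graph is connected if non-empty and not a disjoint union of two non-empty ones; the wheel $W_n$ ($n\ge1$) is the directed graph with $A,I,N,O$ all of cardinality $n$, all structure maps bijective and $tq^{-1}ps^{-1}$ a cyclic permutation; acyclic means admitting no morphism from any $W_n$. From here on ''graph'' means connected acyclic directed graph; $\mathbf{Gr}$ is the category of graphs and etale maps. The unit graph $U$ has one edge and no nodes; the corolla $C^m_n$ is $m+n\leftarrow m\to1\leftarrow n\to m+n$ with the sum inclusions; $\mathbf{elGr}\subset\mathbf{Gr}$ is the full subcategory on $U$ and all $C^m_n$, $m,n\geq 0$. BI-COLLECTIONS AND THE MONAD. A bi-collection is a presheaf $F:\mathbf{elGr}^{op}\to\mathbf{Set}$, $F[m,n]=F[C^m_n]$. A graph $X$ is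 regarded as the bi-collection $E\mapsto\mathrm{Hom}_{\mathbf{Gr}}(E,X)$. For a graph $G$, $\mathrm{el}(G)=\mathbf{elGr}\downarrow G$ (up to equivalence: objects the edges and nodes of $G$, non-identity arrows the flags, each going from its edge to its node) and $F[G]=\lim_{E\in\mathrm{el}(G)}F[E]$. An $F$-graph is a graph $G$ with an element of $F[G]$; $\mathbf{Gr}\downarrow F$ is the category of $F$-graphs (for $F$ given by a graph $Y$, it is the category of graphs with an etale map to $Y$). $\mathrm{res}(G)$ is the corolla with the same imports and exports as $G$ ($\mathrm{res}(U)=C^1_1$); an $(m,n)$-$F$-graph is an $F$-graph with an isomorphism $\mathrm{res}(G)\simeq C^m_n$. The free-properad monad is $F\mapsto\overline F$, $\overline F[U]=F[U]$, $\overline F[m,n]$ = set of isomorphism classes of $(m,n)$-$F$-graphs; the unit views an $F$-corolla as an $F$-graph; the multiplication glues the $F$-graphs decorating the nodes of a graph along the inner edges of that graph. $\widetilde{\mathbf{Gr}}$: objects are graphs, morphisms $R\to Y$ are morphisms of bi-collections $R\to\overline Y$, with Kleisli composition. Free maps are those in the image of $\mathbf{Gr}\to\widetilde{\mathbf{Gr}}$, i.e. coming from etale maps. Explicitly a morphism $R\to Y$ is given by (an isomorphism class of) a residue-compatible graph of $Y$-graphs: a functor $\gamma:\mathrm{el}(R)\to\mathbf{Gr}\downarrow Y$ sending each edge of $R$ to a unit graph over $Y$, sending each in-flag (out-flag) to an import-preserving (export-preserving) map, i.e. one sending the edge to an import (export), and such that for each node $x$ of $R$ with value $G_x$ the ports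 of $x$ are thereby identified with the ports of $G_x$, i.e. $\mathrm{res}(x)\simeq\mathrm{res}(G_x)$ (where $\mathrm{res}(x)$ is the corolla of in- and out-flags at $x$). The colimit of $\gamma$ is a graph $Q$ with an etale map $Q\to Y$. The morphism is called a refinement if $Q\to Y$ is invertible. *)

(* Defs.v *)
From mathcomp Require Import all_boot.
From mathcomp Require Import boolp.

Set Implicit Arguments.
Unset Strict Implicit.
Unset Printing Implicit Defensive.

(* The diagram  A <-s- I -p-> N <-q- O -t-> A. *)
Record digraph := Digraph {
  edge : finType;
  iflag : finType;
  node : finType;
  oflag : finType;
  dg_s : iflag -> edge;
  dg_p : iflag -> node;
  dg_q : oflag -> node;
  dg_t : oflag -> edge;
  dg_s_inj : injective dg_s;
  dg_t_inj : injective dg_t }.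

Arguments dg_s : clear implicits.
Arguments dg_p : clear implicits.
Arguments dg_q : clear implicits.
Arguments dg_t : clear implicits.

Definition is_import (G : digraph) (a : edge G) : bool := a \notin codom (dg_t G).
Definition is_export (G : digraph) (a : edge G) : bool := a \notin codom (dg_s G).

Record dmor (G H : digraph) := DMor {
  fA : edge G -> edge H;
  fI : iflag G -> iflag H;
  fN : node G -> node H;
  fO : oflag G -> oflag H;
  f_s : forall i, dg_s H (fI i) = fA (dg_s G i);
  f_p : forall i, dg_p H (fI i) = fN (dg_p G i);
  f_q : forall o, dg_q H (fO o) = fN (dg_q G o);
  f_t : forall o, dg_t H (fO o) = fA (dg_t G o) }.

Lemma dmor_ext (G H : digraph) (f g : dmor G H) :
  fA f =1 fA g -> fI f =1 fI g -> fN f =1 fN g -> fO f =1 fO g -> f = g.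
Proof.
case: f g => [a i n o p1 p2 p3 p4] [a' i' n' o' q1 q2 q3 q4] /=.
move=> /funext eA /funext eI /funext eN /funext eO.
move: eA eI eN eO p1 p2 p3 p4 => -> -> -> -> p1 p2 p3 p4.
by f_equal; apply: Prop_irrelevance.
Qed.

Definition dcomp (G H K : digraph) (g : dmor H K) (f : dmor G H) : dmor G K.
Proof.
refine (@DMor G K (fA g \o fA f) (fI g \o fI f) (fN g \o fN f) (fO g \o fO f)
         _ _ _ _) => x /=.
- by rewrite !f_s.
- by rewrite !f_p.
- by rewrite !f_q.
- by rewrite !f_t.
Defined.

(* The commutative square  r \o t = b \o l  is a pullback of sets. *)
Definition is_pullback (X Y Z W : Type)
    (t : X -> Y) (l : X -> Z) (r : Y -> W) (b : Z -> W) : Prop :=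
  (forall x, r (t x) = b (l x)) /\
  forall y z, r y = b z -> exists! x, t x = y /\ l x = z.

Record etale (G H : digraph) := Etale {
  et_mor :> dmor G H;
  et_in : is_pullback (fI et_mor) (dg_p G) (dg_p H) (fN et_mor);
  et_out : is_pullback (fO et_mor) (dg_q G) (dg_q H) (fN et_mor) }.

Lemma etale_ext (G H : digraph) (f g : etale G H) :
  et_mor f = et_mor g -> f = g.
Proof.
case: f g => [f p q] [g p' q'] /= e; move: e p q => -> p q.
by f_equal; apply: Prop_irrelevance.
Qed.

Lemma pb_id (X Y : Type) (l : X -> Y) : is_pullback id l l id.
Proof.
split=> // y z /= <-; exists y; split=> // x' [-> _] //.
Qed.

Lemma pb_comp (X Y Z X' Y' Z' : Type) (t1 : X -> Y) (t2 : Y -> Z)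
    (l : X -> X') (m : Y -> Y') (r : Z -> Z') (b1 : X' -> Y') (b2 : Y' -> Z') :
  is_pullback t1 l m b1 -> is_pullback t2 m r b2 ->
  is_pullback (t2 \o t1) l r (b2 \o b1).
Proof.
move=> [c1 u1] [c2 u2]; split=> [x|y z /= e]; first by rewrite /= c2 c1.
have [y' [[ey mz] uy]] := u2 _ _ e.
have [x [[ex lx] ux]] := u1 _ _ mz.
exists x; split=> [|x' /= [e1 e2]]; first by rewrite /= ex.
by apply: ux; split=> //; apply/esym/uy; split=> //; rewrite c1 e2.
Qed.

Definition did (G : digraph) : dmor G G :=
  @DMor G G id id id id (fun=> erefl) (fun=> erefl) (fun=> erefl) (fun=> erefl).

Definition eid (G : digraph) : etale G G :=
  @Etale G G (did G) (pb_id (dg_p G)) (pb_id (dg_q G)).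

Definition ecomp (G H K : digraph) (g : etale H K) (f : etale G H) : etale G K :=
  @Etale G K (dcomp g f) (pb_comp (et_in f) (et_in g)) (pb_comp (et_out f) (et_out g)).

Notation "g \oe f" := (ecomp g f) (at level 50, left associativity).

Lemma ecomp_idl (G H : digraph) (f : etale G H) : eid H \oe f = f.
Proof. by apply: etale_ext; apply: dmor_ext. Qed.

Lemma ecomp_idr (G H : digraph) (f : etale G H) : f \oe eid G = f.
Proof. by apply: etale_ext; apply: dmor_ext. Qed.

Lemma ecompA (G H K L : digraph) (h : etale K L) (g : etale H K) (f : etale G H) :
  h \oe (g \oe f) = h \oe g \oe f.
Proof. by apply: etale_ext; apply: dmor_ext. Qed.

(* Inverses are sought among etale maps; this loses nothing, since a levelwise
   invertible morphism has a levelwise inverse and both are etale. *)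
Definition invertible (G H : digraph) (u : etale G H) : Prop :=
  exists v : etale H G, v \oe u = eid G /\ u \oe v = eid H.

Lemma invertible_comp (G H K : digraph) (g : etale H K) (f : etale G H) :
  invertible g -> invertible f -> invertible (g \oe f).
Proof.
move=> [g' [g1 g2]] [f' [f1 f2]]; exists (f' \oe g'); split.
- by rewrite ecompA -(ecompA f') g1 ecomp_idr.
- by rewrite ecompA -(ecompA g) f2 ecomp_idr.
Qed.

Lemma invertible_id (G : digraph) : invertible (eid G).
Proof. by exists (eid G); rewrite ecomp_idl. Qed.

Definition dsum (G H : digraph) : digraph.
Proof.
refine (@Digraph (edge G + edge H)%type (iflag G + iflag H)%type
  (node G + node H)%type (oflag G + oflag H)%type
  (fun i => match i with inl i => inl (dg_s G i) | inr i => inr (dg_s H i) end)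
  (fun i => match i with inl i => inl (dg_p G i) | inr i => inr (dg_p H i) end)
  (fun o => match o with inl o => inl (dg_q G o) | inr o => inr (dg_q H o) end)
  (fun o => match o with inl o => inl (dg_t G o) | inr o => inr (dg_t H o) end)
  _ _).
- by move=> [i|i] [j|j] // [] /dg_s_inj ->.
- by move=> [i|i] [j|j] // [] /dg_t_inj ->.
Defined.

Definition nonempty (G : digraph) : Prop := inhabited (edge G + node G).

Definition connected (G : digraph) : Prop :=
  nonempty G /\
  ~ exists G1 G2 : digraph, [/\ nonempty G1, nonempty G2 &
      exists u : etale G (dsum G1 G2), invertible u].

(* The wheel with n.+1 edges, so that n ranges over all natural numbers. *)
Definition wheel (n : nat) : digraph :=
  @Digraph 'I_n.+1 'I_n.+1 'I_n.+1 'I_n.+1 id id id (@ordS n.+1)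
    (@inj_id _) (@ordS_inj n.+1).

Definition acyclic (G : digraph) : Prop := forall n, dmor (wheel n) G -> False.

(* Objects of Gr; its morphisms are the etale maps. *)
Record graph := Graph {
  gr_dg :> digraph;
  gr_connected : connected gr_dg;
  gr_acyclic : acyclic gr_dg }.

Definition unit_dg : digraph.
Proof.
refine (@Digraph unit void void void
  (fun i => match i with end) (fun i => match i with end)
  (fun o => match o with end) (fun o => match o with end) _ _); by case.
Defined.

(* The corolla with arbitrary finite sets of in- and out-flags. *)
Definition corolla_dg (I O : finType) : digraph.
Proof.
refine (@Digraph (I + O)%type I unit O inl (fun=> tt) (fun=> tt) inr _ _).
- by move=> i j [].
- by move=> i j [].
Defined.

Lemma unit_connected : connected unit_dg.
Proof.
split; first by constructor; left; exact: tt.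
move=> [G1 [G2 [[x1] [x2] [u [v [_ uv]]]]]].
have eN z : fN u (fN v z) = z.
  by move: (congr1 (fun w : etale _ _ => fN w z) uv).
have eA z : fA u (fA v z) = z.
  by move: (congr1 (fun w : etale _ _ => fA w z) uv).
case: x1 => [a1|n1]; last by case: (fN v (inl n1)).
case: x2 => [a2|n2]; last by case: (fN v (inr n2)).
have := eA (inl a1); have := eA (inr a2).
by case: (fA v _); case: (fA v _) => ->.
Qed.

Lemma unit_acyclic : acyclic unit_dg.
Proof. by move=> n u; case: (fN u ord0). Qed.

Lemma corolla_connected I O : connected (corolla_dg I O).
Proof.
split; first by constructor; right; exact: tt.
move=> [G1 [G2 [ne1 ne2 [u [v [_ uv]]]]]].
have eN z : fN u (fN v z) = z.
  by move: (congr1 (fun w : etale _ _ => fN w z) uv).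
have eA z : fA u (fA v z) = z.
  by move: (congr1 (fun w : etale _ _ => fA w z) uv).
have side (z : edge (dsum G1 G2)) :
    match z, fN u tt with inl _, inl _ | inr _, inr _ => True | _, _ => False end.
  rewrite -[z]eA; case: (fA v z) => [i|o] /=.
  - have := f_s u i; have := f_p u i => /=.
    by case: (fI u i) => j /= <- <-.
  - have := f_t u o; have := f_q u o => /=.
    by case: (fO u o) => j /= <- <-.
have nside (z : node (dsum G1 G2)) : fN u tt = z.
  by rewrite -[RHS]eN; case: (fN v z).
case: ne1 => - [a1|n1]; case: ne2 => - [a2|n2].
- by have := side (inl a1); have := side (inr a2); case: (fN u tt).
- by have := side (inl a1); rewrite (nside (inr n2)).
- by have := side (inr a2); rewrite (nside (inl n1)).
- by have := nside (inl n1); rewrite (nside (inr n2)).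
Qed.

Lemma corolla_acyclic I O : acyclic (corolla_dg I O).
Proof.
move=> n u; have := f_t u ord0; have := f_s u (ordS ord0) => /= <-.
by case.
Qed.

Definition unit_graph : graph := Graph unit_connected unit_acyclic.
Definition corolla (I O : finType) : graph :=
  Graph (@corolla_connected I O) (@corolla_acyclic I O).

(* An etale map between corollas is bijective on flags, hence invertible. *)
Lemma corolla_etale_inv (I O I' O' : finType)
  (u : etale (corolla I O) (corolla I' O')) : invertible u.
Proof.
have tt_eq (x : unit) : tt = x by case: x.
have pI i' := (et_in u).2 i' tt; have pO o' := (et_out u).2 o' tt.
have rI i' : {i : I | fI u i = i'}.
  by apply: cid; have [i [[e _] _]] := pI i' (tt_eq _); exists i.
have rO o' : {o : O | fO u o = o'}.
  by apply: cid; have [o [[e _] _]] := pO o' (tt_eq _); exists o.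
have iI : injective (fI u).
  move=> i j e; have [k [_ uk]] := pI (fI u i) (tt_eq _).
  by rewrite -(uk i) ?(uk j) //; split=> //; case: (dg_p _ _).
have iO : injective (fO u).
  move=> i j e; have [k [_ uk]] := pO (fO u i) (tt_eq _).
  by rewrite -(uk i) ?(uk j) //; split=> //; case: (dg_q _ _).
pose vI i' := projT1 (rI i'); pose vO o' := projT1 (rO o').
have uvI i' : fI u (vI i') = i' := projT2 (rI i').
have uvO o' : fO u (vO o') = o' := projT2 (rO o').
have vuI i : vI (fI u i) = i by apply: iI; rewrite uvI.
have vuO o : vO (fO u o) = o by apply: iO; rewrite uvO.
pose v0 := @DMor (corolla I' O') (corolla I O)
  (fun a => match a with inl i => inl (vI i) | inr o => inr (vO o) end)
  vI id vO (fun=> erefl) (fun=> erefl) (fun=> erefl) (fun=> erefl).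
have pbI : is_pullback (fI v0) (dg_p (corolla I' O')) (dg_p (corolla I O)) (fN v0).
  split=> // y z _; exists (fI u y); split=> [|x' [/= <- _]]; last exact: uvI.
  by split; [exact: vuI | case: z].
have pbO : is_pullback (fO v0) (dg_q (corolla I' O')) (dg_q (corolla I O)) (fN v0).
  split=> // y z _; exists (fO u y); split=> [|x' [/= <- _]]; last exact: uvO.
  by split; [exact: vuO | case: z].
have uA a : fA u a = match a with inl i => inl (fI u i) | inr o => inr (fO u o) end.
  by case: a => [i|o]; [rewrite -(f_s u i)|rewrite -(f_t u o)].
exists (Etale pbI pbO); split; apply: etale_ext; apply: dmor_ext => //=.
- by move=> a; rewrite /= uA; case: a => [i|o] /=; rewrite ?vuI ?vuO.
- by move=> x; case: (fN u x); case: x.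
- by move=> a; rewrite /= uA; case: a => [i|o] /=; rewrite ?uvI ?uvO.
- by move=> x; case: (fN u x); case: x.
Qed.

(* The objects of the skeletal category of elementary graphs. *)
Inductive elt := elU | elC of nat & nat.

Definition el_graph (E : elt) : graph :=
  match E with elU => unit_graph | elC m n => corolla 'I_m 'I_n end.
Coercion el_graph : elt >-> graph.

Record bicoll := BiColl {
  bc_ob :> elt -> Type;
  bc_act : forall E E' : elt, etale E E' -> bc_ob E' -> bc_ob E;
  bc_id : forall (E : elt) (x : bc_ob E), bc_act (eid E) x = x;
  bc_comp : forall (E E' E'' : elt) (g : etale E' E'') (f : etale E E') x,
    bc_act (g \oe f) x = bc_act f (bc_act g x) }.

Record bc_mor (F F' : bicoll) := BCMor {
  bm_fun :> forall E : elt, F E -> F' E;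
  bm_nat : forall (E E' : elt) (f : etale E E') x,
    bm_fun (bc_act f x) = bc_act f (bm_fun x) }.

Definition bm_comp (F F' F'' : bicoll) (g : bc_mor F' F'') (f : bc_mor F F') :
  bc_mor F F''.
Proof.
by refine (@BCMor F F'' (fun E x => g E (f E x)) _) => E E' h x; rewrite !bm_nat.
Defined.

Definition yo (X : graph) : bicoll.
Proof.
refine (@BiColl (fun E => etale E X) (fun E E' f a => a \oe f) _ _).
- by move=> E x; rewrite ecomp_idr.
- by move=> *; rewrite ecompA.
Defined.

Definition yo_mor (X Y : graph) (u : etale X Y) : bc_mor (yo X) (yo Y).
Proof.
by refine (@BCMor (yo X) (yo Y) (fun E a => u \oe a) _) => *; rewrite /= ecompA.
Defined.

(* F[G], the limit of F over el(G) = elGr/G: a family of elements of F[E]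
   indexed by the objects E -> G and compatible with the arrows over G. *)
Definition sect (F : bicoll) (G : graph) : Type := bc_mor (yo G) F.

Record Fgraph (F : bicoll) := FGraph {
  fg_gr :> graph;
  fg_dec : sect F fg_gr }.

Definition is_fgmor (F : bicoll) (G H : Fgraph F) (u : etale G H) : Prop :=
  forall (E : elt) (a : etale E G), fg_dec H E (u \oe a) = fg_dec G E a.

Record fgmor (F : bicoll) (G H : Fgraph F) := FGMor {
  fm_et :> etale G H;
  fm_dec : is_fgmor fm_et }.

(* An edge, regarded as an etale map from the unit graph. *)
Definition edge_dmor (G : digraph) (a : edge G) : dmor unit_dg G.
Proof.
by refine (@DMor unit_dg G (fun=> a) (fun i => match i with end)
  (fun x => match x with end) (fun o => match o with end) _ _ _ _); case.
Defined.

Definition edge_map (G : digraph) (a : edge G) : etale unit_dg G.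
Proof.
by refine (@Etale unit_dg G (edge_dmor a) _ _); split=> [[]|? []].
Defined.

Lemma unit_ext (G : graph) (f g : etale unit_dg G) : fA f tt = fA g tt -> f = g.
Proof. by move=> e; apply: etale_ext; apply: dmor_ext; case. Qed.

Definition imports (G : digraph) : finType := {a : edge G | is_import a}.
Definition exports (G : digraph) : finType := {a : edge G | is_export a}.

Definition res (G : graph) : graph := corolla (imports G) (exports G).

Definition res_edge (G : graph) (a : edge (res G)) : edge G :=
  match a with inl a => val a | inr a => val a end.

Record mngraph (F : bicoll) (m n : nat) := MNGraph {
  mn_fg :> Fgraph F;
  mn_lab : etale (corolla 'I_m 'I_n) (res mn_fg);
  mn_labP : invertible mn_lab }.

Definition port (F : bicoll) (m n : nat) (X : mngraph F m n)
    (a : edge (corolla 'I_m 'I_n)) : edge X :=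
  res_edge (fA (mn_lab X) a).

(* The last clause says  res(u) \o mn_lab X = mn_lab X',  tested on edges, which
   determine an etale map between corollas. *)
Definition mn_isom (F : bicoll) (m n : nat) (X X' : mngraph F m n) : Prop :=
  exists u : etale X X',
    [/\ invertible u, is_fgmor u & forall a, fA u (port X a) = port X' a].

Lemma mn_isom_refl F m n (X : mngraph F m n) : mn_isom X X.
Proof.
exists (eid X); split=> // [|E a]; first exact: invertible_id.
by rewrite ecomp_idl.
Qed.

Lemma mn_isom_sym F m n (X X' : mngraph F m n) : mn_isom X X' -> mn_isom X' X.
Proof.
move=> [u [[v [vu uv]] uF uP]]; exists v; split; first by exists u.
- by move=> E a; rewrite -uF ecompA uv ecomp_idl.
- move=> a; rewrite -uP.
  exact: (congr1 (fun w : etale X X => fA w (port X a)) vu).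
Qed.

Lemma mn_isom_trans F m n (X X' X'' : mngraph F m n) :
  mn_isom X X' -> mn_isom X' X'' -> mn_isom X X''.
Proof.
move=> [u [ui uF uP]] [v [vi vF vP]]; exists (v \oe u); split.
- exact: invertible_comp.
- by move=> E a; rewrite -ecompA vF uF.
- by move=> a; rewrite /= uP vP.
Qed.

Definition isoclass (F : bicoll) (m n : nat) : Type :=
  {P : mngraph F m n -> Prop | exists X, P = mn_isom X}.

Definition cls F m n (X : mngraph F m n) : isoclass F m n :=
  exist _ (mn_isom X) (ex_intro _ X erefl).

Definition rep F m n (P : isoclass F m n) : mngraph F m n :=
  projT1 (cid (proj2_sig P)).

Lemma repK F m n (P : isoclass F m n) : cls (rep P) = P.
Proof.
rewrite /rep; case: (cid _) => X /= eP.
by case: P eP => P hP /= eP; apply: eq_exist; rewrite eP.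
Qed.

Lemma clsP F m n (X X' : mngraph F m n) : cls X = cls X' <-> mn_isom X X'.
Proof.
split=> [|XX'].
  move=> /(congr1 (fun P : isoclass F m n => proj1_sig P X')) /= ->.
  exact: mn_isom_refl.
apply: eq_exist; apply: funext => Z; apply: propext; split.
- exact/mn_isom_trans/mn_isom_sym.
- exact: mn_isom_trans.
Qed.

Lemma rep_cls F m n (X : mngraph F m n) : mn_isom (rep (cls X)) X.
Proof. by apply/clsP; rewrite repK. Qed.

Definition relabel F m n m' n' (h : etale (elC m n) (elC m' n'))
    (X : mngraph F m' n') : mngraph F m n :=
  @MNGraph F m n X (mn_lab X \oe h)
    (invertible_comp (mn_labP X) (corolla_etale_inv h)).

Definition port_dec F m n (X : mngraph F m n) (a : edge (corolla 'I_m 'I_n)) : F elU :=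
  fg_dec X elU (edge_map (port X a)).

Lemma mn_isom_relabel F m n m' n' (h : etale (elC m n) (elC m' n'))
  (X X' : mngraph F m' n') : mn_isom X X' -> mn_isom (relabel h X) (relabel h X').
Proof. by move=> [u [ui uF uP]]; exists u; split=> // a; apply: uP. Qed.

Lemma mn_isom_port_dec F m n (X X' : mngraph F m n) a :
  mn_isom X X' -> port_dec X a = port_dec X' a.
Proof.
move=> [u [ui uF uP]]; rewrite /port_dec -uF.
by congr (fg_dec X' _); apply: unit_ext; rewrite /= uP.
Qed.

Definition bar_ob (F : bicoll) (E : elt) : Type :=
  match E with elU => F elU | elC m n => isoclass F m n end.

(* Restriction to a port evaluates the decoration at the corresponding edge;
   automorphisms of a corolla act on labellings. *)
Definition bar_act (F : bicoll) (E E' : elt) : etale E E' -> bar_ob F E' -> bar_ob F E :=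
  match E, E' return etale E E' -> bar_ob F E' -> bar_ob F E with
  | elU, elU => fun h x => bc_act h x
  | elU, elC m n => fun h P => port_dec (rep P) (fA h tt)
  | elC m n, elU => fun h _ => match fN h tt with end
  | elC m n, elC m' n' => fun h P => cls (relabel h (rep P))
  end.

Lemma bar_act_clsU F m n (h : etale elU (elC m n)) (X : mngraph F m n) :
  bar_act h (cls X : bar_ob F (elC m n)) = port_dec X (fA h tt).
Proof. exact/mn_isom_port_dec/rep_cls. Qed.

Lemma bar_act_clsC F m n m' n' (h : etale (elC m n) (elC m' n')) (X : mngraph F m' n') :
  bar_act h (cls X : bar_ob F (elC m' n')) = cls (relabel h X).
Proof. exact/clsP/mn_isom_relabel/rep_cls. Qed.

Definition bar (F : bicoll) : bicoll.
Proof.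
refine (@BiColl (bar_ob F) (@bar_act F) _ _).
- case=> [|m n] x; first exact: bc_id.
  rewrite -[x]repK bar_act_clsC; apply/clsP.
  exists (eid _); split=> // [|E a]; first exact: invertible_id.
  by rewrite ecomp_idl.
- move=> E E' E'' g f.
  case: E'' g => [|m'' n''] g x.
    case: E' g f => [|m' n'] g f; last by case: (fN g tt).
    by case: E f => [|m n] f; [exact: bc_comp|case: (fN f tt)].
  rewrite -[x]repK; case: E' g f => [|m' n'] g f.
    case: E f => [|m n] f; last by case: (fN f tt).
    rewrite !bar_act_clsU /=.
    have -> : f = eid unit_graph by apply: unit_ext; case: (fA f tt).
    by rewrite bc_id.
  case: E f => [|m n] f; first by rewrite bar_act_clsC !bar_act_clsU.
  rewrite !bar_act_clsC; apply/clsP; exists (eid _).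
  split=> // [|E a]; first exact: invertible_id.
  by rewrite ecomp_idl.
Defined.

Definition fg_push (F F' : bicoll) (g : bc_mor F F') (G : Fgraph F) : Fgraph F' :=
  @FGraph F' G (bm_comp g (fg_dec G)).

Definition mn_push (F F' : bicoll) (g : bc_mor F F') m n (X : mngraph F m n) :
    mngraph F' m n :=
  @MNGraph F' m n (fg_push g X) (mn_lab X) (mn_labP X).

Lemma mn_isom_push F F' (g : bc_mor F F') m n (X X' : mngraph F m n) :
  mn_isom X X' -> mn_isom (mn_push g X) (mn_push g X').
Proof.
move=> [u [ui uF uP]]; exists u; split=> // E a.
by rewrite /= uF.
Qed.

Definition bar_fun (F F' : bicoll) (g : bc_mor F F') (E : elt) : bar F E -> bar F' E :=
  match E return bar_ob F E -> bar_ob F' E with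
  | elU => g elU
  | elC m n => fun P => cls (mn_push g (rep P))
  end.

Lemma bar_fun_cls F F' (g : bc_mor F F') m n (X : mngraph F m n) :
  bar_fun g (cls X : bar F (elC m n)) = cls (mn_push g X).
Proof. exact/clsP/mn_isom_push/rep_cls. Qed.

Definition bar_mor (F F' : bicoll) (g : bc_mor F F') : bc_mor (bar F) (bar F').
Proof.
refine (@BCMor (bar F) (bar F') (bar_fun g) _) => E E' h x.
case: E' h x => [|m' n'] h x.
  by case: E h => [|m n] h; [exact: (bm_nat g h)|case: (fN h tt)].
rewrite -[x]repK bar_fun_cls; case: E h => [|m n] h.
- by rewrite [RHS]bar_act_clsU [bc_act _ _]bar_act_clsU.
- rewrite [RHS]bar_act_clsC [bc_act _ _]bar_act_clsC bar_fun_cls; apply/clsP.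
  exists (eid _); split=> // [|E a]; first exact: invertible_id.
  by rewrite ecomp_idl.
Defined.

Lemma corolla_import (I O : finType) (i : I) :
  is_import (inl i : edge (corolla I O)).
Proof. by apply/negP; case/codomP. Qed.

Lemma corolla_export (I O : finType) (o : O) :
  is_export (inr o : edge (corolla I O)).
Proof. by apply/negP; case/codomP. Qed.

Definition corolla_res_dmor (I O : finType) : dmor (corolla I O) (res (corolla I O)) :=
  let vi i : imports (corolla I O) := exist _ (inl i) (corolla_import O i) in
  let vo o : exports (corolla I O) := exist _ (inr o) (corolla_export I o) in
  @DMor (corolla I O) (res (corolla I O))
    (fun a => match a with inl i => inl (vi i) | inr o => inr (vo o) end)
    vi id vo (fun=> erefl) (fun=> erefl) (fun=> erefl) (fun=> erefl).

Definition corolla_res (I O : finType) : etale (corolla I O) (res (corolla I O)).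
Proof.
refine (@Etale _ _ (corolla_res_dmor I O) _ _).
- split=> [x|y z _]; first reflexivity.
  case: z; case: y => y yP; case: y yP => [i|o] yP.
  + by exists i; split=> [|j [[->]]] //; split=> //; apply: val_inj.
  + by case/negP: yP; apply/codomP; exists o.
- split=> [x|y z _]; first reflexivity.
  case: z; case: y => y yP; case: y yP => [i|o] yP.
  + by case/negP: yP; apply/codomP; exists i.
  + by exists o; split=> [|j [[->]]] //; split=> //; apply: val_inj.
Defined.

Definition yoneda (F : bicoll) (E : elt) (x : F E) : sect F E :=
  @BCMor (yo E) F (fun E' a => bc_act a x) (fun _ _ f a => bc_comp a f x).

Definition fcorolla (F : bicoll) (m n : nat) (x : F (elC m n)) : mngraph F m n :=
  @MNGraph F m n (FGraph (yoneda x)) (corolla_res 'I_m 'I_n)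
    (corolla_etale_inv (corolla_res 'I_m 'I_n)).

Lemma port_fcorolla (F : bicoll) (m n : nat) (x : F (elC m n)) a :
  port (fcorolla x) a = a.
Proof. by case: a. Qed.

Definition bar_unit_fun (F : bicoll) (E : elt) : F E -> bar F E :=
  match E return F E -> bar_ob F E with
  | elU => id
  | elC m n => fun x => cls (fcorolla x)
  end.

Definition bar_unit (F : bicoll) : bc_mor F (bar F).
Proof.
refine (@BCMor F (bar F) (@bar_unit_fun F) _) => E E' h.
case: E' h => [|m' n'] h x; first by case: E h => [|m n] h; last case: (fN h tt).
case: E h => [|m n] h.
- rewrite [RHS]bar_act_clsU /port_dec port_fcorolla /=.
  by congr (bc_act _ x); apply: unit_ext.
- rewrite [RHS]bar_act_clsC; apply/clsP; exists h; split.
  + exact: corolla_etale_inv.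
  + by move=> E a; apply: bc_comp.
  + move=> a; rewrite port_fcorolla.
    exact/esym/(port_fcorolla x (fA h a)).
Defined.

(* A residue-compatible graph of F-graphs over R: a functor to the category of
   F-graphs from the skeletal el(R), whose objects are the edges and nodes of R
   and whose non-identity arrows are the flags (no two of them compose).  A flag
   at the node x is a flag together with a proof that it lies over x. *)
Record gog (F : bicoll) (R : graph) := Gog {
  gog_e : edge R -> Fgraph F;
  gog_n : node R -> Fgraph F;
  gog_i : forall x i, dg_p R i = x -> fgmor (gog_e (dg_s R i)) (gog_n x);
  gog_o : forall x o, dg_q R o = x -> fgmor (gog_e (dg_t R o)) (gog_n x);
  gog_unit : forall e, exists u : etale unit_graph (gog_e e), invertible u;
  gog_import : forall x i (h : dg_p R i = x) a, is_import (fA (gog_i h) a);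
  gog_export : forall x o (h : dg_q R o = x) a, is_export (fA (gog_o h) a);
  gog_res_in : forall x (b : edge (gog_n x)), is_import b ->
    exists! i, exists (h : dg_p R i = x) a, fA (gog_i h) a = b;
  gog_res_out : forall x (b : edge (gog_n x)), is_export b ->
    exists! o, exists (h : dg_q R o = x) a, fA (gog_o h) a = b }.

(* The graph of F-graphs presents the element d of (bar F)[R]: over each node,
   seen as an etale map c from a corolla, d is the class of the F-graph at that
   node, labelled through  C^m_n = res(node) = res(F-graph). *)
Definition presents (F : bicoll) (R : graph) (g : gog F R) (d : sect (bar F) R) : Prop :=
  (forall (e : edge R) (k : etale elU (gog_e g e)),
     (d elU (edge_map e : etale elU R) : F elU) = fg_dec (gog_e g e) elU k) /\
  forall (m n : nat) (c : etale (elC m n) R),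
    exists (l : etale (corolla 'I_m 'I_n) (res (gog_n g (fN c tt)))) (lP : invertible l),
    let X := MNGraph lP in
    [/\ d (elC m n) c = cls X,
        forall (i : 'I_m) a, fA (gog_i g (f_p c i)) a = port X (inl i) &
        forall (o : 'I_n) a, fA (gog_o g (f_q c o)) a = port X (inr o)].

Record cocone (F : bicoll) (R : graph) (g : gog F R) (Z : Fgraph F) := Cocone {
  cc_e : forall e, fgmor (gog_e g e) Z;
  cc_n : forall x, fgmor (gog_n g x) Z;
  cc_i : forall x i (h : dg_p R i = x),
    cc_n x \oe gog_i g h = cc_e (dg_s R i);
  cc_o : forall x o (h : dg_q R o = x),
    cc_n x \oe gog_o g h = cc_e (dg_t R o) }.

Definition is_colimit (F : bicoll) (R : graph) (g : gog F R) (K : Fgraph F)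
    (c : cocone g K) : Prop :=
  forall (Z : Fgraph F) (c' : cocone g Z),
    exists! u : fgmor K Z,
      (forall e, u \oe cc_e c e = cc_e c' e) /\
      (forall x, u \oe cc_n c x = cc_n c' x).

(* K is obtained by gluing, along the inner edges of X, the F-graphs decorating
   the nodes of X; the ports of K are those of X. *)
Definition glues (F : bicoll) (m n : nat) (X : mngraph (bar F) m n)
    (K : mngraph F m n) : Prop :=
  exists (g : gog F X) (c : cocone g K),
    [/\ presents g (fg_dec X), is_colimit c &
        forall p a, fA (cc_e c (port X p)) a = port K p].

(* The multiplication  bar (bar F) -> bar F,  as a functional relation: gluing is
   a colimit, hence determined up to isomorphism by its input. *)
Definition bar_mult (F : bicoll) (E : elt) : bar (bar F) E -> bar F E -> Prop :=
  match E return bar_ob (bar F) E -> bar_ob F E -> Prop with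
  | elU => fun x y => x = y
  | elC m n => fun x y => exists X K, [/\ x = cls X, y = cls K & glues X K]
  end.

Definition khom (R Y : graph) : Type := bc_mor (yo R) (bar (yo Y)).

(* h is the Kleisli composite  R -> bar S -> bar (bar Y) -> bar Y  of f and g. *)
Definition kcomp (R S Y : graph) (f : khom R S) (g : khom S Y) (h : khom R Y) : Prop :=
  forall (E : elt) (a : etale E R), bar_mult (bar_mor g E (f E a)) (h E a).

Definition free_map (R Y : graph) (u : etale R Y) : khom R Y :=
  bm_comp (bar_unit (yo Y)) (yo_mor u).

Definition is_free (R Y : graph) (f : khom R Y) : Prop :=
  exists u : etale R Y, f = free_map u.

Definition is_free_iso (R Y : graph) (f : khom R Y) : Prop :=
  exists u : etale R Y, invertible u /\ f = free_map u.

(* The decoration of the colimit K by the bi-collection of Y is the etale map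
   v : K -> Y. *)
Definition refinement (R Y : graph) (f : khom R Y) : Prop :=
  exists (g : gog (yo Y) R) (K : Fgraph (yo Y)) (c : cocone g K) (v : etale K Y),
    [/\ presents g f, is_colimit c,
        forall (E : elt) (a : etale E K), fg_dec K E a = v \oe a & invertible v].

Definition factorisation (R Y : graph) (f : khom R Y)
    (Q : graph) (r : khom R Q) (m : khom Q Y) : Prop :=
  [/\ refinement r, is_free m & kcomp r m f].

Definition compatible_free_iso (R Y Q Q' : graph) (r : khom R Q) (m : khom Q Y)
    (r' : khom R Q') (m' : khom Q' Y) (i : khom Q Q') : Prop :=
  [/\ is_free_iso i, kcomp r i r' & kcomp i m' m].

(* Main.v *)
Require Import Defs.
From mathcomp Require Import all_boot.
From mathcomp Require Import boolp.

Set Implicit Arguments.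
Unset Strict Implicit.
Unset Printing Implicit Defensive.

(** A morphism R -> Y of the Kleisli category is the same thing as a graph of
    Y-graphs over R, up to isomorphism: each node x of R carries a graph G_x with
    an etale map to Y, whose ports are the flags of R at x.  Gluing the G_x along
    the edges of R gives a graph Q with an etale map to Y.  The same graph of
    graphs, with the inclusions G_x -> Q as decorations, presents a refinement
    R -> Q, and the map Q -> Y is the free part of the factorisation.

    The substance of existence is that Q is a graph.  Its nodes and flags are the
    disjoint unions of those of the G_x; this makes the inclusions etale.  Its
    edges are a quotient of the edges of R together with the edges of the G_x:
    the edge of an in-flag at x is identified with the matching import of G_x, the
    edge of an out-flag with the matching export.  Orient the identifications
    along R: an edge of R hops to an import of the next G_x, an export of a G_x
    hops to an edge of R.  This is a partial injection without cycles because R is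
    acyclic ([hop_inj], [hop_acyclic]), so every class is a finite path; it is
    represented by its last element.  The edge of an in-flag of G_x is not an
    export, hence it is the last element of its class; the edge of an out-flag is
    not an import, hence it is the first one.  So in-flags, and likewise
    out-flags, with the same edge in Q are equal.  A wheel in Q would give one in
    Y, so Q is acyclic; it is connected because R and all the G_x are, which is
    best seen on two-colourings ([glue_connected]).

    Uniqueness rests on two facts.  First, over the bi-collection of a graph,
    being a colimit of decorated graphs is the same as having the universal
    property among undecorated ones ([gluing_colimit], [colimit_gluing]); hence a
    gluing over Q is also a gluing over Y.  Secondly, two graphs of graphs
    presenting the same morphism are isomorphic ([presents_iso]), since equality
    of isomorphism classes at each node provides isomorphisms compatible with the
    ports.  Pushing the two refinements forward to Y therefore gives isomorphic
    gluings over Y, and these gluings are Q and Q'.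

    Kleisli composition is needed only with a free map as second factor, where it
    is pushing decorations forward ([kcomp_freeP]): the relevant gluing is that of
    the stars of the nodes of a graph, and it gives the graph back.

    The isomorphisms at the nodes involve a choice.  It is seen in the refinement
    of an isolated node into a graph without ports covering another one: each deck
    transformation is a comparison isomorphism.  An example is the oriented
    zigzag on four nodes, which covers a pair of parallel edges twice. *)

(** * Etale maps *)

(** The structure maps s and t are injective, so flags follow their edges. *)
Lemma dmor_eq (G H : digraph) (f g : dmor G H) :
  fA f =1 fA g -> fN f =1 fN g -> f = g.
Proof.
move=> eA eN; apply: dmor_ext => // [i|o].
- by apply: dg_s_inj; rewrite !f_s eA.
- by apply: dg_t_inj; rewrite !f_t eA.
Qed.

Lemma etale_eq (G H : digraph) (f g : etale G H) :
  fA f =1 fA g -> fN f =1 fN g -> f = g.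
Proof. by move=> eA eN; apply/etale_ext/dmor_eq. Qed.

Lemma pullback_intro (X Y Z W : Type) (t : X -> Y) (l : X -> Z) (r : Y -> W) (b : Z -> W) :
  (forall x, r (t x) = b (l x)) ->
  (forall y z, r y = b z -> exists2 x, t x = y & l x = z) ->
  (forall x x', t x = t x' -> l x = l x' -> x = x') ->
  is_pullback t l r b.
Proof.
move=> sq ex inj; split=> // y z /ex [x xy xz]; exists x; split=> // x' [ty lz].
by apply: inj; rewrite ?ty ?lz.
Qed.

Lemma pullback_lift (X Y Z W : Type) (t : X -> Y) (l : X -> Z) (r : Y -> W) (b : Z -> W) :
  is_pullback t l r b ->
  forall y z, r y = b z -> exists2 x, t x = y & l x = z.
Proof. by move=> [_ u] y z /u [x [[xy xz] _]]; exists x. Qed.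

Lemma pullback_inj (X Y Z W : Type) (t : X -> Y) (l : X -> Z) (r : Y -> W) (b : Z -> W) :
  is_pullback t l r b ->
  forall x x', t x = t x' -> l x = l x' -> x = x'.
Proof.
move=> [sq u] x x' et el; have [z [_ uz]] := u _ _ (sq x).
by rewrite -(uz x) ?(uz x').
Qed.

(** Bijectivity on flags is automatic: the flags at a node are matched with those
    at its image. *)
Lemma bij_invertible (G H : digraph) (u : etale G H) :
  bijective (fA u) -> bijective (fN u) -> invertible u.
Proof.
move=> [gA uA gAK] [gN uN gNK].
have /choice [gI gIP] i' : exists i, fI u i = i' /\ dg_p G i = gN (dg_p H i').
  by have [|i] := pullback_lift (et_in u) (y := i') (z := gN (dg_p H i')); [|exists i].
have /choice [gO gOP] o' : exists o, fO u o = o' /\ dg_q G o = gN (dg_q H o').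
  by have [|o] := pullback_lift (et_out u) (y := o') (z := gN (dg_q H o')); [|exists o].
have gs i : dg_s G (gI i) = gA (dg_s H i).
  by have [<- _] := gIP i; rewrite f_s uA; have [-> _] := gIP i.
have gt o : dg_t G (gO o) = gA (dg_t H o).
  by have [<- _] := gOP o; rewrite f_t uA; have [-> _] := gOP o.
pose v := @DMor H G gA gI gN gO gs (fun i => (gIP i).2) (fun o => (gOP o).2) gt.
have gIK i : gI (fI u i) = i.
  apply: (pullback_inj (et_in u)); first by rewrite (gIP _).1.
  by rewrite (gIP _).2 f_p uN.
have gOK o : gO (fO u o) = o.
  apply: (pullback_inj (et_out u)); first by rewrite (gOP _).1.
  by rewrite (gOP _).2 f_q uN.
have pbi : is_pullback (fI v) (dg_p H) (dg_p G) (fN v).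
  apply: pullback_intro => [i|i z /= e|i j /= e _]; first exact: f_p.
    by exists (fI u i); rewrite ?gIK // f_p e gNK.
  by rewrite -(gIP i).1 e (gIP j).1.
have pbo : is_pullback (fO v) (dg_q H) (dg_q G) (fN v).
  apply: pullback_intro => [i|i z /= e|i j /= e _]; first exact: f_q.
    by exists (fO u i); rewrite ?gOK // f_q e gNK.
  by rewrite -(gOP i).1 e (gOP j).1.
by exists (Etale pbi pbo); split; apply: etale_eq => x /=.
Qed.

Lemma inverse_fA (G H : digraph) (u : etale G H) (v : etale H G) :
  v \oe u = eid G -> cancel (fA u) (fA v).
Proof. by move=> e a; move: (congr1 (fun w : etale _ _ => fA w a) e). Qed.

Lemma inverse_fN (G H : digraph) (u : etale G H) (v : etale H G) :
  v \oe u = eid G -> cancel (fN u) (fN v).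
Proof. by move=> e a; move: (congr1 (fun w : etale _ _ => fN w a) e). Qed.

(** * Connectedness through two-colourings *)

Definition colouring (G : digraph) (cA : edge G -> bool) (cN : node G -> bool) : Prop :=
  (forall i, cA (dg_s G i) = cN (dg_p G i)) /\
  (forall o, cA (dg_t G o) = cN (dg_q G o)).

Section Part.
Variables (G : digraph) (cA : edge G -> bool) (cN : node G -> bool).
Hypothesis cP : colouring cA cN.

Lemma part_s b (i : {i | cN (dg_p G i) == b}) : cA (dg_s G (val i)) == b.
Proof. by rewrite cP.1 (valP i). Qed.

Lemma part_t b (o : {o | cN (dg_q G o) == b}) : cA (dg_t G (val o)) == b.
Proof. by rewrite cP.2 (valP o). Qed.

Definition part (b : bool) : digraph.
Proof.
refine (@Digraph {a | cA a == b} {i | cN (dg_p G i) == b} {x | cN x == b}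
  {o | cN (dg_q G o) == b}
  (fun i => exist _ (dg_s G (val i)) (part_s i))
  (fun i => exist _ (dg_p G (val i)) (valP i))
  (fun o => exist _ (dg_q G (val o)) (valP o))
  (fun o => exist _ (dg_t G (val o)) (part_t o)) _ _).
- by move=> i j [] /dg_s_inj /val_inj.
- by move=> i j [] /dg_t_inj /val_inj.
Defined.

(** The map of the sum of the two colour classes back to the whole, on each of the
    four levels. *)
Definition unpart (T : Type) (f : T -> bool)
    (a : {a | f a == true} + {a | f a == false}) : T :=
  match a with inl a => val a | inr a => val a end.

Lemma unpart_inj (T : Type) (f : T -> bool) : injective (@unpart T f).
Proof.
move=> [a|a] [b|b] /= e; first by rewrite (val_inj e).
- by have := valP a; rewrite /= e (eqP (valP b)).
- by have := valP a; rewrite /= e (eqP (valP b)).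
- by rewrite (val_inj e).
Qed.

Lemma unpart_surj (T : Type) (f : T -> bool) (a : T) :
  exists a', @unpart T f a' = a.
Proof.
case e: (f a); first by exists (inl (exist _ a (introT eqP e))).
by exists (inr (exist _ a (introT eqP e))).
Qed.

Definition dmor_unpart : dmor (dsum (part true) (part false)) G.
Proof.
by refine (@DMor (dsum (part true) (part false)) G (@unpart _ cA)
  (@unpart _ (cN \o dg_p G)) (@unpart _ cN) (@unpart _ (cN \o dg_q G)) _ _ _ _); case.
Defined.

Lemma unpart_et_in : is_pullback (fI dmor_unpart)
  (dg_p (dsum (part true) (part false))) (dg_p G) (fN dmor_unpart).
Proof.
apply: pullback_intro => [x|i x /= e|i j /= e _]; last exact: unpart_inj e.
  exact: f_p dmor_unpart x.
have [i' ei] := unpart_surj (cN \o dg_p G) i; exists i' => //.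
apply: (@unpart_inj _ cN); rewrite -e -ei.
by case: (i').
Qed.

Lemma unpart_et_out : is_pullback (fO dmor_unpart)
  (dg_q (dsum (part true) (part false))) (dg_q G) (fN dmor_unpart).
Proof.
apply: pullback_intro => [x|i x /= e|i j /= e _]; last exact: unpart_inj e.
  exact: f_q dmor_unpart x.
have [i' ei] := unpart_surj (cN \o dg_q G) i; exists i' => //.
apply: (@unpart_inj _ cN); rewrite -e -ei.
by case: (i').
Qed.

End Part.

Lemma inj_surj_bij (T T' : Type) (f : T -> T') :
  injective f -> (forall y, exists x, f x = y) -> bijective f.
Proof.
move=> inj /choice [g gK]; exists g => // x.
by apply: inj; rewrite gK.
Qed.

(** Connectedness is used in this form: it passes through maps and quotients
    without handling disjoint unions. *)
Lemma connected_colouring (G : digraph) : connected G ->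
  forall cA cN, @colouring G cA cN -> exists b, cA =1 (fun=> b) /\ cN =1 (fun=> b).
Proof.
move=> [ne ndec] cA cN cP; apply: contrapT => nb; apply: ndec.
pose u := Etale (unpart_et_in cP) (unpart_et_out cP).
have [v [uv vu]] : invertible u.
  apply: bij_invertible; apply: inj_surj_bij; try exact: unpart_inj.
  - exact: unpart_surj.
  - exact: unpart_surj.
have side b : nonempty (part cP b).
  apply: contrapT => e; apply: nb; exists (~~ b); split=> a.
  - case: (eqVneq (cA a) b) => [ca|]; last by case: (cA a); case: (b).
    by case: e; split; left; exists a; apply/eqP.
  - case: (eqVneq (cN a) b) => [ca|]; last by case: (cN a); case: (b).
    by case: e; split; right; exists a; apply/eqP.
exists (part cP true), (part cP false); split=> //.
by exists v, u.
Qed.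

Definition in_left (T T' : Type) (x : T + T') : bool :=
  if x is inl _ then true else false.

Lemma colouring_connected (G : digraph) : nonempty G ->
  (forall cA cN, @colouring G cA cN -> exists b, cA =1 (fun=> b) /\ cN =1 (fun=> b)) ->
  connected G.
Proof.
move=> ne mono; split=> // - [G1 [G2 [[x1] [x2] [u [v [uv vu]]]]]].
have [|b [bA bN]] := mono (fun a => in_left (fA u a)) (fun a => in_left (fN u a)).
  split=> [i|o].
  - by rewrite -f_s -f_p /=; case: (fI u i).
  - by rewrite -f_t -f_q /=; case: (fO u o).
have eA := inverse_fA vu; have eN := inverse_fN vu.
have b1 : b = true.
  by case: x1 => [a|a]; [rewrite -(bA (fA v (inl a))) eA|rewrite -(bN (fN v (inl a))) eN].
have b2 : b = false.
  by case: x2 => [a|a]; [rewrite -(bA (fA v (inr a))) eA|rewrite -(bN (fN v (inr a))) eN].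
by rewrite b1 in b2.
Qed.

(** * Corollas and stars of nodes *)

Section CorollaMap.
Variables (I O I' O' : finType) (fi : I -> I') (fo : O -> O').

Definition corolla_dmor : dmor (corolla_dg I O) (corolla_dg I' O') :=
  @DMor (corolla_dg I O) (corolla_dg I' O')
    (fun a => match a with inl i => inl (fi i) | inr o => inr (fo o) end)
    fi id fo (fun=> erefl) (fun=> erefl) (fun=> erefl) (fun=> erefl).

Hypotheses (fi_bij : bijective fi) (fo_bij : bijective fo).

Lemma corolla_et_in : is_pullback (fI corolla_dmor) (dg_p (corolla_dg I O))
  (dg_p (corolla_dg I' O')) (fN corolla_dmor).
Proof.
apply: pullback_intro => // [i' [] _|i j /(bij_inj fi_bij) //].
by case: fi_bij => g _ gK; exists (g i') => //; exact: gK.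
Qed.

Lemma corolla_et_out : is_pullback (fO corolla_dmor) (dg_q (corolla_dg I O))
  (dg_q (corolla_dg I' O')) (fN corolla_dmor).
Proof.
apply: pullback_intro => // [i' [] _|i j /(bij_inj fo_bij) //].
by case: fo_bij => g _ gK; exists (g i') => //; exact: gK.
Qed.

Definition corolla_map : etale (corolla_dg I O) (corolla_dg I' O') :=
  Etale corolla_et_in corolla_et_out.

End CorollaMap.

Lemma corolla_fI_inj (I O : finType) (G : digraph) (c : etale (corolla_dg I O) G) :
  injective (fI c).
Proof. by move=> i j e; apply: (pullback_inj (et_in c) e). Qed.

Lemma corolla_fO_inj (I O : finType) (G : digraph) (c : etale (corolla_dg I O) G) :
  injective (fO c).
Proof. by move=> i j e; apply: (pullback_inj (et_out c) e). Qed.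

Lemma corolla_fI_onto (I O : finType) (G : digraph) (c : etale (corolla_dg I O) G) i' :
  dg_p G i' = fN c tt -> exists i, fI c i = i'.
Proof. by move=> /(pullback_lift (et_in c)) [i]; exists i. Qed.

Lemma corolla_fO_onto (I O : finType) (G : digraph) (c : etale (corolla_dg I O) G) o' :
  dg_q G o' = fN c tt -> exists o, fO c o = o'.
Proof. by move=> /(pullback_lift (et_out c)) [o]; exists o. Qed.

(** An etale map from a corolla is determined by its node up to the numbering of
    the flags. *)
Lemma corolla_factor (I O I' O' : finType) (G : digraph)
    (c : etale (corolla_dg I O) G) (c' : etale (corolla_dg I' O') G) :
  fN c tt = fN c' tt ->
  exists h : etale (corolla_dg I O) (corolla_dg I' O'), c = c' \oe h.
Proof.
move=> e.
have /choice [fi fiP] i : exists i', fI c' i' = fI c i.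
  by apply: corolla_fI_onto; rewrite f_p.
have /choice [fo foP] o : exists o', fO c' o' = fO c o.
  by apply: corolla_fO_onto; rewrite f_q.
have fi_bij : bijective fi.
  apply: inj_surj_bij => [i j eij|i'].
    by apply: (corolla_fI_inj (c := c)); rewrite -!fiP eij.
  have [|i ei] := corolla_fI_onto (c := c) (i' := fI c' i').
    by rewrite f_p e; congr (fN c' _); case: (dg_p _ _).
  by exists i; apply: (corolla_fI_inj (c := c')); rewrite fiP.
have fo_bij : bijective fo.
  apply: inj_surj_bij => [i j eij|i'].
    by apply: (corolla_fO_inj (c := c)); rewrite -!foP eij.
  have [|i ei] := corolla_fO_onto (c := c) (o' := fO c' i').
    by rewrite f_q e; congr (fN c' _); case: (dg_q _ _).
  by exists i; apply: (corolla_fO_inj (c := c')); rewrite foP.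
exists (corolla_map fi_bij fo_bij); apply: etale_eq => [[i|o]|[]] //=.
- by rewrite -(f_s c i) -(f_s c' (fi i)) fiP.
- by rewrite -(f_t c o) -(f_t c' (fo o)) foP.
Qed.

Section Star.
Variables (G : digraph) (x : node G).

Definition in_at : finType := {i | dg_p G i == x}.
Definition out_at : finType := {o | dg_q G o == x}.

Definition star_dmor : dmor (corolla_dg in_at out_at) G :=
  @DMor (corolla_dg in_at out_at) G
    (fun a => match a with inl i => dg_s G (val i) | inr o => dg_t G (val o) end)
    val (fun=> x) val (fun=> erefl) (fun i => eqP (valP i)) (fun o => eqP (valP o))
    (fun=> erefl).

Lemma star_et_in : is_pullback (fI star_dmor) (dg_p (corolla_dg in_at out_at))
  (dg_p G) (fN star_dmor).
Proof.
apply: pullback_intro => [i|i [] /= /eqP e|i j /= /val_inj //]; first exact: f_p star_dmor i.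
by exists (exist _ i e).
Qed.

Lemma star_et_out : is_pullback (fO star_dmor) (dg_q (corolla_dg in_at out_at))
  (dg_q G) (fN star_dmor).
Proof.
apply: pullback_intro => [i|i [] /= /eqP e|i j /= /val_inj //]; first exact: f_q star_dmor i.
by exists (exist _ i e).
Qed.

Definition star : graph := corolla in_at out_at.
Definition star_map : etale star G := Etale star_et_in star_et_out.

(** Bi-collections only see corollas on the standard finite sets, so the star is
    reindexed along an enumeration of its flags. *)
Definition chart : etale (elC #|in_at| #|out_at|) G :=
  star_map \oe corolla_map (enum_val_bij in_at) (enum_val_bij out_at).

Lemma corolla_chart (I O : finType) (c : etale (corolla_dg I O) G) :
  fN c tt = x -> exists h : etale (corolla_dg I O) (elC #|in_at| #|out_at|), c = chart \oe h.
Proof. by move=> e; apply: corolla_factor. Qed.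

End Star.

(** * Decorations by a graph are etale maps *)

Lemma bc_mor_eq (F F' : bicoll) (f g : bc_mor F F') :
  (forall E x, f E x = g E x) -> f = g.
Proof.
case: f g => [f fn] [g gn] /= e.
have {}e : f = g by apply: functional_extensionality_dep => E; apply: funext.
by move: fn gn; rewrite e => fn gn; congr BCMor; apply: Prop_irrelevance.
Qed.

Lemma unit_dom_eq (G : digraph) (f g : etale unit_dg G) : fA f tt = fA g tt -> f = g.
Proof. by move=> e; apply: etale_eq; case. Qed.

Lemma edge_mapK (G : digraph) (f : etale unit_dg G) : edge_map (fA f tt) = f.
Proof. exact: unit_dom_eq. Qed.

Lemma edge_map_comp (G H : digraph) (u : etale G H) (a : edge G) :
  u \oe edge_map a = edge_map (fA u a).
Proof. exact: unit_dom_eq. Qed.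

Section SectMap.
Variables (X Y : graph) (d : sect (yo Y) X).

Let dE (a : edge X) : edge Y := fA (d elU (edge_map a) : etale unit_dg Y) tt.
Let dC x : etale (elC _ _) Y := d (elC _ _) (chart x).

Lemma sect_edge m n (c : etale (elC m n) X) a :
  fA (d (elC m n) c : etale (elC m n) Y) a = dE (fA c a).
Proof.
pose k : etale elU (elC m n) := edge_map a.
have := bm_nat d k c => /(congr1 (fun f : etale unit_dg Y => fA f tt)) /= <-.
by congr (fA (d elU _) tt); exact: edge_map_comp.
Qed.

Lemma sect_node m n (c : etale (elC m n) X) :
  fN (d (elC m n) c : etale (elC m n) Y) tt = fN (dC (fN c tt)) tt.
Proof.
have [h ->] := corolla_chart (c := c) erefl.
have -> : d (elC m n) (chart (fN c tt) \oe h) = dC (fN c tt) \oe h.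
  exact: (bm_nat d (E := elC m n) (E' := elC _ _) h).
by move=> /=; congr (fN _ _); case: (fN h tt).
Qed.

Lemma chart_in (x : node X) i : dg_p X i = x -> exists k, fI (chart x) k = i.
Proof. by move=> e; apply: corolla_fI_onto. Qed.

Lemma chart_out (x : node X) o : dg_q X o = x -> exists k, fO (chart x) k = o.
Proof. by move=> e; apply: corolla_fO_onto. Qed.

(** Density of the elementary graphs, for maps into a graph: the values of a
    section at single edges and at charts of nodes assemble to a map, and the
    naturality of the section makes them agree on flags. *)
Lemma section_is_etale : exists v : etale X Y, d = yo_mor v.
Proof.
pose ki i := projT1 (cid (chart_in (erefl (dg_p X i)))).
pose ko o := projT1 (cid (chart_out (erefl (dg_q X o)))).
have kiP i : fI (chart (dg_p X i)) (ki i) = i := projT2 (cid (chart_in _)).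
have koP o : fO (chart (dg_q X o)) (ko o) = o := projT2 (cid (chart_out _)).
pose vN x := fN (dC x) tt.
pose vI i := fI (dC (dg_p X i)) (ki i).
pose vO o := fO (dC (dg_q X o)) (ko o).
have vs i : dg_s Y (vI i) = dE (dg_s X i).
  by rewrite f_s sect_edge -(f_s (chart _)) kiP.
have vt o : dg_t Y (vO o) = dE (dg_t X o).
  by rewrite f_t sect_edge -(f_t (chart _)) koP.
have vp i : dg_p Y (vI i) = vN (dg_p X i) by rewrite f_p.
have vq o : dg_q Y (vO o) = vN (dg_q X o) by rewrite f_q.
pose v0 := @DMor X Y dE vI vN vO vs vp vq vt.
have vIK x k : vI (fI (chart x) k) = fI (dC x) k.
  by apply: dg_s_inj; rewrite vs [RHS]f_s sect_edge (f_s (chart x)).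
have vOK x k : vO (fO (chart x) k) = fO (dC x) k.
  by apply: dg_t_inj; rewrite vt [RHS]f_t sect_edge (f_t (chart x)).
have pi : is_pullback (fI v0) (dg_p X) (dg_p Y) (fN v0).
  apply: pullback_intro => [i|i x /= e|i j /= e ex]; first by rewrite /= vp.
    have [k ek] := corolla_fI_onto (c := dC x) e.
    by exists (fI (chart x) k); rewrite ?vIK // f_p.
  have [k ek] := chart_in ex; have [l el] := chart_in (erefl (dg_p X j)).
  have kl : k = l.
    by apply: (corolla_fI_inj (c := dC (dg_p X j))); rewrite -!vIK ek el.
  by rewrite -el -kl ek.
have po : is_pullback (fO v0) (dg_q X) (dg_q Y) (fN v0).
  apply: pullback_intro => [i|i x /= e|i j /= e ex]; first by rewrite /= vq.
    have [k ek] := corolla_fO_onto (c := dC x) e.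
    by exists (fO (chart x) k); rewrite ?vOK // f_q.
  have [k ek] := chart_out ex; have [l el] := chart_out (erefl (dg_q X j)).
  have kl : k = l.
    by apply: (corolla_fO_inj (c := dC (dg_q X j))); rewrite -!vOK ek el.
  by rewrite -el -kl ek.
exists (Etale pi po); apply: bc_mor_eq => [[|m n]] c /=.
- by apply: unit_dom_eq; rewrite /= /dE edge_mapK.
- by apply: etale_eq => [a|[]]; [exact: sect_edge|exact: sect_node].
Qed.

End SectMap.

Lemma yo_mor_inj (X Y : graph) (u v : etale X Y) : yo_mor u = yo_mor v -> u = v.
Proof.
move=> e; have eE (E : elt) (a : etale E X) : u \oe a = v \oe a.
  exact: (congr1 (fun f : bc_mor (yo X) (yo Y) => f E a) e).
apply: etale_eq => [a|x].
- exact: (congr1 (fun w : etale unit_dg Y => fA w tt) (eE elU (edge_map a))).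
- exact: (congr1 (fun w : etale (elC _ _) Y => fN w tt) (eE (elC _ _) (chart x))).
Qed.

(** * Graphs of graphs and the sections they present *)

Section Gog.
Variables (F : bicoll) (R : graph) (g : gog F R).

Definition gog_edge (e : edge R) : edge (gog_e g e) :=
  fA (projT1 (cid (gog_unit g e))) tt.

Lemma gog_edgeP e (a : edge (gog_e g e)) : a = gog_edge e.
Proof.
rewrite /gog_edge; case: (cid _) => u /= [v [vu uv]].
by rewrite -(inverse_fA uv a); case: (fA v a).
Qed.

Lemma gog_edge_collapse e : exists v : etale (gog_e g e) unit_dg, invertible v.
Proof. by have [u [v [vu uv]]] := gog_unit g e; exists v, u. Qed.

Lemma gog_edge_ext e (H : digraph) (u v : etale (gog_e g e) H) :
  fA u (gog_edge e) = fA v (gog_edge e) -> u = v.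
Proof.
move=> euv; have [k _] := gog_edge_collapse e.
apply: etale_eq => [a|x]; first by rewrite (gog_edgeP a).
by case: (fN k x).
Qed.

Definition gog_in x i (h : dg_p R i = x) : edge (gog_n g x) :=
  fA (gog_i g h) (gog_edge (dg_s R i)).
Definition gog_out x o (h : dg_q R o = x) : edge (gog_n g x) :=
  fA (gog_o g h) (gog_edge (dg_t R o)).

Lemma gog_in_import x i (h : dg_p R i = x) : is_import (gog_in h).
Proof. exact: gog_import. Qed.

Lemma gog_out_export x o (h : dg_q R o = x) : is_export (gog_out h).
Proof. exact: gog_export. Qed.

Lemma gog_in_onto x (b : edge (gog_n g x)) :
  is_import b -> exists i (h : dg_p R i = x), gog_in h = b.
Proof.
by move=> /gog_res_in [i [[h [a <-]] _]]; exists i, h; rewrite (gog_edgeP a).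
Qed.

Lemma gog_out_onto x (b : edge (gog_n g x)) :
  is_export b -> exists o (h : dg_q R o = x), gog_out h = b.
Proof.
by move=> /gog_res_out [i [[h [a <-]] _]]; exists i, h; rewrite (gog_edgeP a).
Qed.

Lemma gog_in_inj x i j (h : dg_p R i = x) (h' : dg_p R j = x) :
  gog_in h = gog_in h' -> i = j.
Proof.
move=> e; have [k [_ uk]] := gog_res_in (gog_in_import h).
rewrite -(uk i) ?(uk j) //; first by exists h', (gog_edge _); rewrite -/(gog_in h').
by exists h, (gog_edge _).
Qed.

Lemma gog_out_inj x i j (h : dg_q R i = x) (h' : dg_q R j = x) :
  gog_out h = gog_out h' -> i = j.
Proof.
move=> e; have [k [_ uk]] := gog_res_out (gog_out_export h).
rewrite -(uk i) ?(uk j) //; first by exists h', (gog_edge _); rewrite -/(gog_out h').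
by exists h, (gog_edge _).
Qed.

Section Label.
Variables (m n : nat) (c : etale (elC m n) R) (x : node R) (hx : fN c tt = x).

Definition lab_in (k : 'I_m) : imports (gog_n g x) :=
  exist _ (gog_in (etrans (f_p c k) hx)) (gog_in_import _).
Definition lab_out (k : 'I_n) : exports (gog_n g x) :=
  exist _ (gog_out (etrans (f_q c k) hx)) (gog_out_export _).

Lemma lab_in_bij : bijective lab_in.
Proof.
apply: inj_surj_bij => [k l [] /gog_in_inj /corolla_fI_inj //|[b bi]].
have [i [h e]] := gog_in_onto bi.
have [|k ek] := corolla_fI_onto (c := c) (i' := i); first by rewrite hx.
exists k; apply: val_inj => /=; rewrite -e; subst i.
by congr gog_in; apply: Prop_irrelevance.
Qed.

Lemma lab_out_bij : bijective lab_out.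
Proof.
apply: inj_surj_bij => [k l [] /gog_out_inj /corolla_fO_inj //|[b bi]].
have [i [h e]] := gog_out_onto bi.
have [|k ek] := corolla_fO_onto (c := c) (o' := i); first by rewrite hx.
exists k; apply: val_inj => /=; rewrite -e; subst i.
by congr gog_out; apply: Prop_irrelevance.
Qed.

(** The graph at the node under a corolla c, with its ports labelled through the
    flags of c.  The node x is a parameter so that restriction along a map of
    corollas, which fixes the node only up to a proof, needs no transport. *)
Definition gog_node : mngraph F m n :=
  @MNGraph F m n (gog_n g x) (corolla_map lab_in_bij lab_out_bij)
    (corolla_etale_inv (corolla_map lab_in_bij lab_out_bij)).

End Label.

Lemma gog_node_cls m n (c : etale (elC m n) R) x (hx : fN c tt = x) :
  cls (gog_node hx) = cls (gog_node (erefl (fN c tt))).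
Proof. by case: x / hx. Qed.

Definition gog_edge_dec (e : edge R) : F elU :=
  fg_dec (gog_e g e) elU (edge_map (gog_edge e)).

(** A presentation leaves no freedom: the labellings quantified over in the
    definition are forced by the flags. *)
Lemma presentsP (d : sect (bar F) R) : presents g d <->
  (forall e, d elU (edge_map e) = gog_edge_dec e) /\
  (forall m n (c : etale (elC m n) R), d (elC m n) c = cls (gog_node (erefl (fN c tt)))).
Proof.
split=> - [dU dC]; split=> [e|m n c]; [exact: dU| |move=> k|].
- have [l [lP [-> li lo]]] := dC m n c; apply/clsP.
  exists (eid _); split=> [||[i|o]]; first exact: invertible_id.
  - by move=> E a; rewrite ecomp_idl.
  - rewrite /= -(li _ (gog_edge _)) /port /=.
    by congr (fA (gog_i g _) _); apply: Prop_irrelevance.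
  - rewrite /= -(lo _ (gog_edge _)) /port /=.
    by congr (fA (gog_o g _) _); apply: Prop_irrelevance.
- by rewrite dU -(edge_mapK k) (gog_edgeP (fA k tt)).
- pose X := gog_node (erefl (fN c tt)).
  exists (mn_lab X), (mn_labP X : invertible (mn_lab X)); split.
  + by rewrite dC.
  + move=> i a; rewrite (gog_edgeP a) /port /=.
    by congr (fA (gog_i g _) _); apply: Prop_irrelevance.
  + move=> i a; rewrite (gog_edgeP a) /port /=.
    by congr (fA (gog_o g _) _); apply: Prop_irrelevance.
Qed.

Lemma gog_in_dec x i (h : dg_p R i = x) :
  fg_dec (gog_n g x) elU (edge_map (gog_in h)) = gog_edge_dec (dg_s R i).
Proof.
rewrite /gog_edge_dec -(fm_dec (gog_i g h)); congr (fg_dec _ _ _).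
exact/esym/edge_map_comp.
Qed.

Lemma gog_out_dec x i (h : dg_q R i = x) :
  fg_dec (gog_n g x) elU (edge_map (gog_out h)) = gog_edge_dec (dg_t R i).
Proof.
rewrite /gog_edge_dec -(fm_dec (gog_o g h)); congr (fg_dec _ _ _).
exact/esym/edge_map_comp.
Qed.

(** The section presented by g.  This is how a refinement is obtained from a graph
    of graphs decorated by the inclusions into its gluing. *)
Definition gog_sect_fun (E : elt) : yo R E -> bar F E :=
  match E return yo R E -> bar_ob F E with
  | elU => fun a => gog_edge_dec (fA (a : etale unit_dg R) tt)
  | elC m n => fun c => cls (gog_node (erefl (fN (c : etale (elC m n) R) tt)))
  end.

Lemma gog_sect_nat (E E' : elt) (h : etale E E') a :
  gog_sect_fun (bc_act h a) = bc_act h (gog_sect_fun a).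
Proof.
case: E' h a => [|m' n'] h a.
  case: E h => [|m n] h; last by case: (fN h tt).
  have -> : h = eid unit_graph by apply: unit_dom_eq; case: (fA h tt).
  by rewrite !bc_id.
case: E h => [|m n] h.
- rewrite [RHS]bar_act_clsU /port_dec /=.
  case: (fA h tt) => [i|o].
  + by rewrite [port _ _]/= gog_in_dec f_s.
  + by rewrite [port _ _]/= gog_out_dec f_t.
- rewrite [RHS]bar_act_clsC /=.
  have hx : fN (a \oe h) tt = fN (a : etale (elC m' n') R) tt.
    by rewrite /=; case: (fN h tt).
  rewrite -(gog_node_cls hx); apply/clsP.
  exists (eid _); split=> [||[i|o]]; first exact: invertible_id.
  + by move=> E b; rewrite ecomp_idl.
  + rewrite /port /= -(f_s h i) /=.
    by congr gog_in; apply: Prop_irrelevance.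
  + rewrite /port /= -(f_t h o) /=.
    by congr gog_out; apply: Prop_irrelevance.
Qed.

Definition gog_sect : sect (bar F) R := BCMor gog_sect_nat.

Lemma gog_sectP : presents g gog_sect.
Proof. by apply/presentsP; split. Qed.

End Gog.

(** The two unit graphs over an edge are isomorphic in one way only, so maps need
    only be given at the nodes; over an edge the decorations have to agree. *)
Record gog_iso (F : bicoll) (R : graph) (g g' : gog F R)
    (th : forall x, etale (gog_n g x) (gog_n g' x)) : Prop := {
  gog_iso_inv : forall x, invertible (th x);
  gog_iso_dec : forall x, is_fgmor (th x);
  gog_iso_in : forall x i (h : dg_p R i = x), fA (th x) (gog_in g h) = gog_in g' h;
  gog_iso_out : forall x o (h : dg_q R o = x), fA (th x) (gog_out g h) = gog_out g' h;
  gog_iso_edge : forall e, gog_edge_dec g e = gog_edge_dec g' e }.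

(** The isomorphism at a node comes from the equality of two isomorphism classes;
    this choice is what makes the comparison of factorisations non-canonical. *)
Lemma presents_iso F R (g g' : gog F R) d :
  presents g d -> presents g' d -> exists th, @gog_iso F R g g' th.
Proof.
move=> /presentsP [dU dC] /presentsP [dU' dC'].
have thx x : exists u : etale (gog_n g x) (gog_n g' x),
  [/\ invertible u, is_fgmor u,
      forall i (h : dg_p R i = x), fA u (gog_in g h) = gog_in g' h &
      forall o (h : dg_q R o = x), fA u (gog_out g h) = gog_out g' h].
  have : cls (gog_node g (erefl (fN (chart x) tt))) =
         cls (gog_node g' (erefl (fN (chart x) tt))) by rewrite -dC -dC'.
  move=> /clsP [u [ui ud up]]; exists u; split=> // [i h|o h].
  - have [k ek] := chart_in h; subst i.
    rewrite (Prop_irrelevance h (etrans (f_p (chart x) k) erefl)).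
    exact: up (inl k).
  - have [k ek] := chart_out h; subst o.
    rewrite (Prop_irrelevance h (etrans (f_q (chart x) k) erefl)).
    exact: up (inr k).
exists (fun x => projT1 (cid (thx x))); split=> [x|x|x|x|e]; last by rewrite -dU -dU'.
all: by case: (cid _) => u [].
Qed.

Lemma iso_presents F R (g g' : gog F R) d d' th :
  @gog_iso F R g g' th -> presents g d -> presents g' d' -> d = d'.
Proof.
move=> [ti td tin tout te] /presentsP [dU dC] /presentsP [dU' dC'].
apply: bc_mor_eq => [[|m n]] c.
- by rewrite -(edge_mapK c) [LHS]dU [RHS]dU'; apply: te.
- rewrite [LHS]dC [RHS]dC'; apply/clsP; exists (th _); split.
  + exact: ti.
  + exact: td.
  + by case=> [i|o]; [exact: tin|exact: tout].
Qed.

(** * Iterating a partial injection without cycles *)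

Section Terminus.
Variables (V : finType) (hop : V -> V).
Hypothesis hop_inj : forall v w, hop v <> v -> hop w <> w -> hop v = hop w -> v = w.
Hypothesis hop_acyclic : forall v n, iter n.+1 hop v = v -> hop v = v.

(** After as many steps as there are points, every path has come to rest. *)
Definition terminus (v : V) : V := iter #|V| hop v.

Lemma terminus_id v : hop v = v -> terminus v = v.
Proof. exact: iter_fix. Qed.

Lemma hop_terminus v : hop (terminus v) = terminus v.
Proof.
have /trajectP [i lt_i e] := looping_order hop v.
have le_V : fingraph.order hop v <= #|V| by apply: max_card.
have wfix : hop (iter i hop v) = iter i hop v.
  apply: (@hop_acyclic _ (fingraph.order hop v - i).-1).
  by rewrite prednK ?subn_gt0 // -iterD subnK 1?ltnW.
rewrite /terminus -(subnK (ltnW (leq_trans lt_i le_V))) iterD.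
by rewrite (iter_fix _ wfix).
Qed.

Lemma terminus_hop v : terminus (hop v) = terminus v.
Proof. by rewrite /terminus -iterSr /= -/(terminus v) hop_terminus. Qed.

Lemma terminus_ind (T : Type) (f : V -> T) :
  (forall v, f (hop v) = f v) -> forall v, f (terminus v) = f v.
Proof. by move=> fh v; rewrite /terminus; elim: #|V| => //= n IH; rewrite fh. Qed.

Definition source v := forall u, hop u = v -> u = v.

(** Two paths with the same end merge; as the steps are injective they can be
    retraced from the merging point, until one of the sources is reached. *)
Lemma terminus_source_inj v w :
  source v -> source w -> terminus v = terminus w -> v = w.
Proof.
move=> sv sw; rewrite /terminus; move: {1}#|V| {1}#|V| => m n.
elim: n m => [|n IHn] m; first by elim: m => //= m IHm /esym e; apply/IHm/esym; apply: sv.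
elim: m => [|m IHm] /=; first by move=> e; apply: (IHn 0); apply: sw.
move=> e; case: (eqVneq (hop (iter n hop v)) (iter n hop v)) => [f1|/eqP f1].
  by apply: (IHn m.+1); rewrite -f1.
case: (eqVneq (hop (iter m hop w)) (iter m hop w)) => [f2|/eqP f2].
  by apply: IHm; rewrite -f2.
by apply: (IHn m); apply: hop_inj.
Qed.

End Terminus.

(** * Gluing a graph of graphs *)

Lemma Tagged_inj (I : eqType) (T_ : I -> eqType) i (x y : T_ i) :
  Tagged T_ x = Tagged T_ y -> x = y.
Proof. by move/eqP; rewrite eq_Tagged => /eqP. Qed.

(** A closed walk along edges and nodes is a map from a wheel. *)
Lemma acyclic_no_cycle (R : digraph) (e : nat -> edge R) n : acyclic R ->
  (forall k, exists i o, [/\ dg_s R i = e k, dg_p R i = dg_q R o & dg_t R o = e k.+1]) ->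
  e n.+1 <> e 0.
Proof.
move=> ac /choice [i /choice [o st]] en.
apply: (ac n); refine (@DMor (wheel n) R e i (fun k => dg_p R (i k)) o _ _ _ _) => k /=.
- by have [] := st k.
- by [].
- by have [_ <-] := st k.
- have [_ _ ->] := st k; have := ltn_ord k; rewrite ltnS leq_eqVlt.
  case/orP => [/eqP ->|lt_k]; first by rewrite modnn.
  by rewrite modn_small.
Qed.

Section Glue.
Variables (F : bicoll) (R : graph) (g : gog F R).

(** Cocones without decorations.  The vertex is any directed graph because the
    glued graph is built, and mapped out of, before it is known to be connected and
    acyclic. *)
Definition gcone (Z : digraph) (zE : forall e, etale (gog_e g e) Z)
    (zN : forall x, etale (gog_n g x) Z) : Prop :=
  (forall x i (h : dg_p R i = x), zN x \oe gog_i g h = zE (dg_s R i)) /\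
  (forall x o (h : dg_q R o = x), zN x \oe gog_o g h = zE (dg_t R o)).

Local Notation inner := {x : node R & edge (gog_n g x)}.
Local Notation V := (edge R + inner)%type.

Definition inner_edge x (b : edge (gog_n g x)) : inner := existT _ x b.
(** The total space of the edges of all node graphs is used from here on, so that
    ports at different nodes can be compared. *)
Definition in_port i : inner := inner_edge (gog_in g (erefl (dg_p R i))).
Definition out_port o : inner := inner_edge (gog_out g (erefl (dg_q R o))).

Lemma inner_edge_inj x : injective (@inner_edge x).
Proof. by move=> b b' /(@Tagged_inj _ (fun x => edge (gog_n g x))). Qed.

Lemma in_portE x i (h : dg_p R i = x) : inner_edge (gog_in g h) = in_port i.
Proof. by subst x. Qed.
Lemma out_portE x o (h : dg_q R o = x) : inner_edge (gog_out g h) = out_port o.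
Proof. by subst x. Qed.

Lemma in_port_inj : injective in_port.
Proof.
move=> i j e; have ht : dg_p R i = dg_p R j := congr1 tag e.
by move: e; rewrite -(in_portE ht) => /inner_edge_inj /gog_in_inj.
Qed.

Lemma out_port_inj : injective out_port.
Proof.
move=> i j e; have ht : dg_q R i = dg_q R j := congr1 tag e.
by move: e; rewrite -(out_portE ht) => /inner_edge_inj /gog_out_inj.
Qed.

(** One identification made by the gluing, oriented along R: an edge entering a
    node becomes the matching import there, an export becomes the edge of R on
    which it leaves. *)
Definition hop (v : V) : V :=
  match v with
  | inl e => if [pick i | dg_s R i == e] is Some i then inr (in_port i) else inl e
  | inr b => if [pick o | out_port o == b] is Some o then inl (dg_t R o) else inr b
  end.

Variant hop_spec : V -> V -> Prop :=
  | HopFix v : hop_spec v v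
  | HopIn i : hop_spec (inl (dg_s R i)) (inr (in_port i))
  | HopOut o : hop_spec (inr (out_port o)) (inl (dg_t R o)).

Lemma hopP v : hop_spec v (hop v).
Proof.
case: v => [e|b] /=.
- by case: pickP => [i /eqP <-|_]; constructor.
- by case: pickP => [o /eqP <-|_]; constructor.
Qed.

Lemma hop_in i : hop (inl (dg_s R i)) = inr (in_port i).
Proof.
rewrite /=; case: pickP => [j /eqP /dg_s_inj -> //|/(_ i)].
by rewrite eqxx.
Qed.

Lemma hop_out o : hop (inr (out_port o)) = inl (dg_t R o).
Proof.
rewrite /=; case: pickP => [j /eqP /out_port_inj -> //|/(_ o)].
by rewrite eqxx.
Qed.

(** A flag is determined by its edge and by its port. *)
Lemma hop_inj v w : hop v <> v -> hop w <> w -> hop v = hop w -> v = w.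
Proof.
case: (hopP v) => [//|i|o]; case: (hopP w) => [//|j|j] // _ _ e.
- have /in_port_inj -> // : in_port i = in_port j.
  exact: (congr1 (fun v => if v is inr b then b else in_port i) e).
- by case: e => /dg_t_inj ->.
Qed.

Lemma hop2 e : hop (inl e) <> inl e -> hop (hop (inl e)) <> hop (inl e) ->
  exists i o, [/\ dg_s R i = e, dg_p R i = dg_q R o & hop (hop (inl e)) = inl (dg_t R o)].
Proof.
have moveE : hop (inl e) <> inl e -> exists2 i, dg_s R i = e & hop (inl e) = inr (in_port i).
  by rewrite /=; case: pickP => [i /eqP <- _|_ //]; exists i.
have moveN b : hop (inr b) <> inr b -> exists2 o, out_port o = b & hop (inr b) = inl (dg_t R o).
  by rewrite /=; case: pickP => [o /eqP <- _|_ //]; exists o.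
move=> /moveE [i si ->] /moveN [o eo ->]; exists i, o; split=> //.
exact/esym/(congr1 tag eo).
Qed.

(** A point that moves and comes back passes alternately through edges of R and
    node graphs; its edges of R, every second iterate, form a closed walk in R. *)
Lemma hop_acyclic v n : iter n.+1 hop v = v -> hop v = v.
Proof.
move=> per; apply: contrapT => mv.
(* A path that ever came to rest could not return to its start. *)
have moving w k : iter n.+1 hop w = w -> hop w <> w ->
    hop (iter k hop w) <> iter k hop w.
  move=> pw mw fk; apply: mw.
  have : iter (k * n.+1) hop w = w by rewrite iterM iter_fix.
  by rewrite mulnSr iterD (iter_fix _ fk) => e; move: fk; rewrite e.
have [w [pw mw [e we]]] : exists w, [/\ iter n.+1 hop w = w, hop w <> w &
    exists e, w = inl e].
  case: v per mv => [e|b] per mv; first by exists (inl e); split=> //; exists e.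
  exists (hop (inr b)); split; first by rewrite -iterSr iterS per.
    exact: (moving _ 1).
  by move: mv => /=; case: pickP => // o _ _; exists (dg_t R o).
(* The default e is never reached. *)
pose E k := if iter k.*2 hop w is inl e' then e' else e.
have EP k : iter k.*2 hop w = inl (E k).
  rewrite /E; elim: k => [|k IH]; first by rewrite /= we.
  case ek: (iter k.*2 hop w) IH => [e'|b] // _.
  rewrite doubleS !iterS ek.
  have m1 := moving _ k.*2 pw mw; have m2 := moving _ k.*2.+1 pw mw.
  rewrite iterS ek in m2; rewrite ek in m1.
  by have [i [o [_ _ ->]]] := hop2 m1 m2.
apply: (@acyclic_no_cycle R E n (@gr_acyclic R)).
  move=> k; have m1 := moving _ k.*2 pw mw; have m2 := moving _ k.*2.+1 pw mw.
  rewrite iterS EP in m2; rewrite EP in m1.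
  have [i [o [si pq e2]]] := hop2 m1 m2; exists i, o; split=> //.
  have : iter k.+1.*2 hop w = inl (dg_t R o) by rewrite doubleS !iterS EP.
  by rewrite EP => - [].
suff [] : inl (E n.+1) = inl (E 0) :> V by [].
by rewrite -(EP n.+1) -(EP 0) -(mul2n n.+1) iterM iter_fix.
Qed.

End Glue.

(** * The glued graph *)

Lemma tagged_map_inj (I : eqType) (T_ S_ : I -> eqType) (f : forall i, T_ i -> S_ i) :
  (forall i, injective (f i)) ->
  injective (fun k : {i & T_ i} => Tagged S_ (f (tag k) (tagged k))).
Proof.
move=> inj [i a] [j b] /= e; have h : i = j := congr1 tag e.
by case: j / h b e => b /Tagged_inj /inj ->.
Qed.

Section GlueGraph.
Variables (F : bicoll) (R : graph) (g : gog F R).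

Local Notation V := (edge R + {x : node R & edge (gog_n g x)})%type.

(** The edges of the gluing: the last points of the paths of identifications. *)
Definition glue_edge : finType := {v : V | hop v == v}.

Definition glue_class (v : V) : glue_edge :=
  exist _ (terminus (@hop _ _ g) v) (introT eqP (hop_terminus (@hop_acyclic _ _ g) v)).

Lemma glue_class_hop v : glue_class (hop v) = glue_class v.
Proof. by apply: val_inj; apply: (terminus_hop (@hop_acyclic _ _ g)). Qed.

Lemma glue_classK w : glue_class (val w) = w.
Proof. by apply: val_inj; apply: terminus_id; apply/eqP: (valP w). Qed.

Lemma glue_class_in x i (h : dg_p R i = x) :
  glue_class (inr (inner_edge (gog_in g h))) = glue_class (inl (dg_s R i)).
Proof. by rewrite in_portE -hop_in glue_class_hop. Qed.

Lemma glue_class_out x o (h : dg_q R o = x) :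
  glue_class (inr (inner_edge (gog_out g h))) = glue_class (inl (dg_t R o)).
Proof. by rewrite out_portE -hop_out glue_class_hop. Qed.

(** Applied to the edges of in-flags, which are not exports: they are their own
    classes, so the map s of the glued graph is injective. *)
Lemma hop_not_export x (b : edge (gog_n g x)) :
  ~~ is_export b -> hop (inr (inner_edge b)) = inr (inner_edge b).
Proof.
move=> nb /=; case: pickP => [o /eqP e|//].
have h : dg_q R o = x := congr1 tag e.
by move: e nb; rewrite -(out_portE g h) => /inner_edge_inj <-; rewrite gog_out_export.
Qed.

(** Applied to the edges of out-flags: they are first in their classes, so the map
    t of the glued graph is injective by [terminus_source_inj]. *)
Lemma source_not_import x (b : edge (gog_n g x)) :
  ~~ is_import b -> source (@hop _ _ g) (inr (inner_edge b)).
Proof.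
move=> nb u; case: (hopP u) => // i e.
have {}e : in_port g i = inner_edge b.
  exact: (congr1 (fun v => if v is inr b then b else in_port g i) e).
have h : dg_p R i = x := congr1 tag e.
by move: e nb; rewrite -(in_portE g h) => /inner_edge_inj <-; rewrite gog_in_import.
Qed.

Definition glue_s (k : {x : node R & iflag (gog_n g x)}) : glue_edge :=
  glue_class (inr (inner_edge (dg_s _ (tagged k)))).
Definition glue_t (k : {x : node R & oflag (gog_n g x)}) : glue_edge :=
  glue_class (inr (inner_edge (dg_t _ (tagged k)))).

Lemma inr_inner_inj (v w : {x : node R & edge (gog_n g x)}) : inr v = inr w :> V -> v = w.
Proof. by move=> e; apply: (congr1 (fun u => if u is inr b then b else v) e). Qed.

Lemma glue_s_inj : injective glue_s.
Proof.
move=> k l /(congr1 val) /=; rewrite /terminus !iter_fix; last first.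
- by apply: hop_not_export; rewrite negbK codom_f.
- by apply: hop_not_export; rewrite negbK codom_f.
move=> /inr_inner_inj.
apply: (@tagged_map_inj _ (fun x => iflag (gog_n g x)) (fun x => edge (gog_n g x))
  (fun x => dg_s (gog_n g x))).
by move=> x; apply: dg_s_inj.
Qed.

Lemma glue_t_inj : injective glue_t.
Proof.
move=> k l /(congr1 val) /= /(terminus_source_inj (@hop_inj _ _ g)) e.
have /inr_inner_inj : inr (inner_edge (dg_t _ (tagged k))) =
    inr (inner_edge (dg_t _ (tagged l))) :> V.
  by apply: e; apply: source_not_import; rewrite negbK codom_f.
apply: (@tagged_map_inj _ (fun x => oflag (gog_n g x)) (fun x => edge (gog_n g x))
  (fun x => dg_t (gog_n g x))).
by move=> x; apply: dg_t_inj.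
Qed.

Definition glue : digraph :=
  @Digraph glue_edge {x : node R & iflag (gog_n g x)} {x : node R & node (gog_n g x)}
    {x : node R & oflag (gog_n g x)} glue_s
    (fun k => Tagged (fun x => node (gog_n g x)) (dg_p _ (tagged k)))
    (fun k => Tagged (fun x => node (gog_n g x)) (dg_q _ (tagged k)))
    glue_t glue_s_inj glue_t_inj.

Section Inclusion.
Variable x : node R.

Definition glue_inc_dmor : dmor (gog_n g x) glue :=
  @DMor (gog_n g x) glue (fun b => glue_class (inr (inner_edge b)))
    (fun i => Tagged (fun x => iflag (gog_n g x)) i)
    (fun n => Tagged (fun x => node (gog_n g x)) n)
    (fun o => Tagged (fun x => oflag (gog_n g x)) o)
    (fun=> erefl) (fun=> erefl) (fun=> erefl) (fun=> erefl).

Lemma glue_inc_in : is_pullback (fI glue_inc_dmor) (dg_p (gog_n g x)) (dg_p glue)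
  (fN glue_inc_dmor).
Proof.
apply: pullback_intro => // [[y i] n /= e|i j].
  have h : y = x := congr1 tag e.
  subst y; exists i => //.
  exact: (@Tagged_inj _ (fun x => node (gog_n g x)) _ _ _ e).
by move=> /(@Tagged_inj _ (fun x => iflag (gog_n g x)) _ _ _).
Qed.

Lemma glue_inc_out : is_pullback (fO glue_inc_dmor) (dg_q (gog_n g x)) (dg_q glue)
  (fN glue_inc_dmor).
Proof.
apply: pullback_intro => // [[y i] n /= e|i j].
  have h : y = x := congr1 tag e.
  subst y; exists i => //.
  exact: (@Tagged_inj _ (fun x => node (gog_n g x)) _ _ _ e).
by move=> /(@Tagged_inj _ (fun x => oflag (gog_n g x)) _ _ _).
Qed.

Definition glue_inc : etale (gog_n g x) glue := Etale glue_inc_in glue_inc_out.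

End Inclusion.

Definition glue_inc_edge (e : edge R) : etale (gog_e g e) glue :=
  edge_map (glue_class (inl e) : edge glue) \oe projT1 (cid (gog_edge_collapse g e)).

Lemma glue_gcone : gcone glue_inc_edge glue_inc.
Proof.
split=> x i h; apply: gog_edge_ext => /=.
- exact: glue_class_in.
- exact: glue_class_out.
Qed.

Section Mediate.
Variables (Z : digraph) (zE : forall e, etale (gog_e g e) Z)
  (zN : forall x, etale (gog_n g x) Z).
Hypothesis zP : gcone zE zN.

Definition glue_med_edge (v : V) : edge Z :=
  match v with
  | inl e => fA (zE e) (gog_edge g e)
  | inr b => fA (zN (tag b)) (tagged b)
  end.

Lemma gcone_in x i (h : dg_p R i = x) :
  fA (zN x) (gog_in g h) = fA (zE (dg_s R i)) (gog_edge g (dg_s R i)).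
Proof. by rewrite -(zP.1 _ _ h). Qed.

Lemma gcone_out x i (h : dg_q R i = x) :
  fA (zN x) (gog_out g h) = fA (zE (dg_t R i)) (gog_edge g (dg_t R i)).
Proof. by rewrite -(zP.2 _ _ h). Qed.

Lemma glue_med_edge_hop v : glue_med_edge (hop v) = glue_med_edge v.
Proof. by case: (hopP v) => // i /=; rewrite ?gcone_in ?gcone_out. Qed.

Lemma glue_med_edge_class v : glue_med_edge (val (glue_class v)) = glue_med_edge v.
Proof. exact: (terminus_ind glue_med_edge_hop). Qed.

Definition glue_med_dmor : dmor glue Z.
Proof.
refine (@DMor glue Z (fun w => glue_med_edge (val w)) (fun k => fI (zN (tag k)) (tagged k))
  (fun k => fN (zN (tag k)) (tagged k)) (fun k => fO (zN (tag k)) (tagged k)) _ _ _ _).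
- by move=> k; rewrite glue_med_edge_class f_s.
- by move=> k; rewrite f_p.
- by move=> k; rewrite f_q.
- by move=> k; rewrite glue_med_edge_class f_t.
Defined.

Lemma glue_med_in : is_pullback (fI glue_med_dmor) (dg_p glue) (dg_p Z) (fN glue_med_dmor).
Proof.
apply: pullback_intro => [k|i [x n] /= e|[x i] [y j] /= e e']; first exact: f_p.
  by have [i' <- <-] := pullback_lift (et_in (zN x)) e; exists (existT _ x i').
have h : x = y := congr1 tag e'.
subst y; have {}e' := @Tagged_inj _ (fun x => node (gog_n g x)) _ _ _ e'.
by rewrite (pullback_inj (et_in (zN x)) e e').
Qed.

Lemma glue_med_out : is_pullback (fO glue_med_dmor) (dg_q glue) (dg_q Z) (fN glue_med_dmor).
Proof.
apply: pullback_intro => [k|i [x n] /= e|[x i] [y j] /= e e']; first exact: f_q.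
  by have [i' <- <-] := pullback_lift (et_out (zN x)) e; exists (existT _ x i').
have h : x = y := congr1 tag e'.
subst y; have {}e' := @Tagged_inj _ (fun x => node (gog_n g x)) _ _ _ e'.
by rewrite (pullback_inj (et_out (zN x)) e e').
Qed.

Definition glue_med : etale glue Z := Etale glue_med_in glue_med_out.

Lemma glue_med_inc_edge e : glue_med \oe glue_inc_edge e = zE e.
Proof. by apply: gog_edge_ext; apply: (glue_med_edge_class (inl e)). Qed.

Lemma glue_med_inc x : glue_med \oe glue_inc x = zN x.
Proof. by apply: etale_eq => // b; apply: (glue_med_edge_class (inr (inner_edge b))). Qed.

End Mediate.

(** The inclusions are jointly surjective. *)
Lemma glue_epi (Z : digraph) (u u' : etale glue Z) :
  (forall e, u \oe glue_inc_edge e = u' \oe glue_inc_edge e) ->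
  (forall x, u \oe glue_inc x = u' \oe glue_inc x) -> u = u'.
Proof.
move=> eE eN; apply: etale_eq => [w|[x n]].
- rewrite -(glue_classK w); case: (val w) => [e|[x b]].
  + exact: (congr1 (fun f : etale _ _ => fA f (gog_edge g e)) (eE e)).
  + exact: (congr1 (fun f : etale _ _ => fA f b) (eN x)).
- exact: (congr1 (fun f : etale _ _ => fN f n) (eN x)).
Qed.

(** A colouring of the gluing is constant on every node graph, hence defines a
    colouring of R. *)
Lemma glue_connected : connected glue.
Proof.
apply: colouring_connected.
  case: (gr_connected R) => - [[e|x]] _.
    by constructor; left; exact: (glue_class (inl e)).
  case: (gr_connected (gog_n g x)) => - [[b|n]] _.
  - by constructor; left; exact: (glue_class (inr (inner_edge b))).
  - by constructor; right; exact: (existT _ x n).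
move=> cA cN [cI cO].
have bxs x : {b | (forall a, cA (glue_class (inr (@inner_edge _ _ g x a))) = b) /\
    (forall n : node (gog_n g x), cN (Tagged (fun x => node (gog_n g x)) n) = b)}.
  apply: cid; have [|b [bA bN]] := connected_colouring (gr_connected (gog_n g x))
    (cA := cA \o fA (glue_inc x)) (cN := cN \o fN (glue_inc x)).
    by split=> k /=; [rewrite -(cI (existT _ x k))|rewrite -(cO (existT _ x k))].
  by exists b; split=> a; [exact: bA|exact: bN].
pose bx x := projT1 (bxs x); have bxP x := projT2 (bxs x).
have [|b [bA bN]] := connected_colouring (gr_connected R)
  (cA := fun e => cA (glue_class (inl e))) (cN := bx).
  split=> k.
  - by rewrite -(glue_class_in (erefl (dg_p R k))) (bxP _).1.
  - by rewrite -(glue_class_out (erefl (dg_q R k))) (bxP _).1.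
exists b; split=> [w|[x n]].
- rewrite -(glue_classK w); case: (val w) => [e|[x a]]; first exact: bA.
  exact: etrans ((bxP x).1 a) (bN x).
- exact: etrans ((bxP x).2 n) (bN x).
Qed.

End GlueGraph.

(** * The universal property of gluing *)

(** The universal property tested against all directed graphs rather than
    decorated ones, with existence and uniqueness kept apart.  It does not mention
    decorations, so it is insensitive to a change of bi-collection. *)
Record gluing (F : bicoll) (R : graph) (g : gog F R) (K : digraph)
    (kE : forall e, etale (gog_e g e) K) (kN : forall x, etale (gog_n g x) K) : Prop := {
  gluing_cone : gcone kE kN;
  gluing_ex : forall (Z : digraph) (zE : forall e, etale (gog_e g e) Z)
      (zN : forall x, etale (gog_n g x) Z), gcone zE zN ->
    exists u : etale K Z, (forall e, u \oe kE e = zE e) /\ (forall x, u \oe kN x = zN x);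
  gluing_epi : forall (Z : digraph) (u u' : etale K Z),
    (forall e, u \oe kE e = u' \oe kE e) -> (forall x, u \oe kN x = u' \oe kN x) ->
    u = u' }.

Lemma glue_gluing F R (g : gog F R) : gluing (glue_inc_edge g) (glue_inc g).
Proof.
split; first exact: glue_gcone; last exact: glue_epi.
move=> Z zE zN zP; exists (glue_med zP); split=> [e|x].
- exact: glue_med_inc_edge.
- exact: glue_med_inc.
Qed.

Lemma cocone_gcone F R (g : gog F R) (K : Fgraph F) (c : cocone g K) :
  gcone (cc_e c) (cc_n c).
Proof. by split=> x i h; rewrite ?cc_i ?cc_o. Qed.

Lemma gluing_transport F R (g : gog F R) (K K' : digraph) kE kN kE' kN'
    (u : etale K K') : gluing (g := g) kE kN -> invertible u ->
  (forall e, u \oe kE e = kE' e) -> (forall x, u \oe kN x = kN' x) ->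
  gluing (g := g) kE' kN'.
Proof.
move=> [cone ex epi] [v [vu uv]] uE uN; split.
- by split=> x i h; rewrite -uN -uE -ecompA ?cone.1 ?cone.2.
- move=> Z zE zN /ex [w [wE wN]]; exists (w \oe v); split=> [e|x].
  + by rewrite -uE -ecompA (ecompA v) vu ecomp_idl.
  + by rewrite -uN -ecompA (ecompA v) vu ecomp_idl.
- move=> Z w w' eE eN; have : w \oe u = w' \oe u.
    by apply: epi => [e|x]; rewrite -!ecompA ?uE ?uN.
  by move/(congr1 (fun f => f \oe v)); rewrite -!ecompA uv !ecomp_idr.
Qed.

(** * Isomorphic graphs of graphs have isomorphic gluings *)

Lemma gog_iso_sym F R (g g' : gog F R) th : @gog_iso F R g g' th ->
  exists2 th', @gog_iso F R g' g th' & forall x, th' x \oe th x = eid _.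
Proof.
move=> [ti td tin tout te].
pose th' x := projT1 (cid (ti x)).
have thK x : th' x \oe th x = eid _ by rewrite /th'; case: (cid _) => v [].
have thK' x : th x \oe th' x = eid _ by rewrite /th'; case: (cid _) => v [].
exists th' => //; split=> [x|x E a|x i h|x o h|e]; first by exists (th x).
- by rewrite -(td x E) ecompA thK' ecomp_idl.
- by rewrite -tin (inverse_fA (thK x)).
- by rewrite -tout (inverse_fA (thK x)).
- by rewrite te.
Qed.

(** On the unit graph over an edge there is only one map to use. *)
Lemma gluing_map F R (g g' : gog F R) th (K K' : digraph) kE kN kE' kN' :
  @gog_iso F R g g' th -> gluing (g := g) (K := K) kE kN ->
  gcone (g := g') (Z := K') kE' kN' ->
  exists u : etale K K', (forall x, u \oe kN x = kN' x \oe th x) /\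
    (forall e, fA u (fA (kE e) (gog_edge g e)) = fA (kE' e) (gog_edge g' e)).
Proof.
move=> [ti td tin tout te] gK cK'.
pose tE e : etale (gog_e g e) (gog_e g' e) :=
  edge_map (gog_edge g' e) \oe projT1 (cid (gog_edge_collapse g e)).
have [|u [uE uN]] := gluing_ex gK (zE := fun e => kE' e \oe tE e)
  (zN := fun x => kN' x \oe th x).
  split=> x i h; apply: gog_edge_ext => /=.
  - by rewrite -/(gog_in g h) tin (gcone_in cK').
  - by rewrite -/(gog_out g h) tout (gcone_out cK').
exists u; split=> // e.
exact: (congr1 (fun f : etale _ _ => fA f (gog_edge g e)) (uE e)).
Qed.

Lemma gluing_iso F R (g g' : gog F R) th (K K' : digraph) kE kN kE' kN' :
  @gog_iso F R g g' th -> gluing (g := g) (K := K) kE kN ->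
  gluing (g := g') (K := K') kE' kN' ->
  exists u : etale K K', [/\ invertible u, forall x, u \oe kN x = kN' x \oe th x &
    forall e, fA u (fA (kE e) (gog_edge g e)) = fA (kE' e) (gog_edge g' e)].
Proof.
move=> thP gK gK'; have [th' thP' thK] := gog_iso_sym thP.
have [u [uN uE]] := gluing_map thP gK (gluing_cone gK').
have [v [vN vE]] := gluing_map thP' gK' (gluing_cone gK).
have thK' x : th x \oe th' x = eid _.
  have [w [_ thw]] := gog_iso_inv thP x.
  by rewrite -(ecomp_idr (th' x)) -thw (ecompA (th' x)) thK ecomp_idl.
exists u; split=> //; exists v; split.
- apply: (gluing_epi gK) => [e|x]; rewrite ecomp_idl.
    by apply: gog_edge_ext; rewrite /= uE vE.
  by rewrite -ecompA uN ecompA vN -ecompA thK ecomp_idr.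
- apply: (gluing_epi gK') => [e|x]; rewrite ecomp_idl.
    by apply: gog_edge_ext; rewrite /= vE uE.
  by rewrite -ecompA vN ecompA uN -ecompA thK' ecomp_idr.
Qed.

(** * Graphs over a graph *)

Lemma fgmor_eq F (G H : Fgraph F) (u v : fgmor G H) : fm_et u = fm_et v -> u = v.
Proof.
case: u v => [u p] [v q] /= e; move: p q; rewrite e => p q.
by congr FGMor; apply: Prop_irrelevance.
Qed.

Section Over.
Variable Y : graph.

(** The structure map to Y of a Y-graph. *)
Definition fg_map (G : Fgraph (yo Y)) : etale G Y :=
  projT1 (cid (section_is_etale (fg_dec G))).

Lemma fg_mapE G : fg_dec G = yo_mor (fg_map G).
Proof. by rewrite /fg_map; case: (cid _). Qed.

Lemma fg_mapK (X : graph) (v : etale X Y) : fg_map (@FGraph (yo Y) X (yo_mor v)) = v.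
Proof. by apply: yo_mor_inj; rewrite -fg_mapE. Qed.

Lemma is_fgmorP (G H : Fgraph (yo Y)) (u : etale G H) :
  is_fgmor u <-> fg_map H \oe u = fg_map G.
Proof.
rewrite /is_fgmor !fg_mapE; split=> e.
  by apply: yo_mor_inj; apply: bc_mor_eq => E a; rewrite -[RHS]e /= ecompA.
by move=> E a; rewrite /= ecompA e.
Qed.

Lemma fg_map_comp (G H : Fgraph (yo Y)) (u : fgmor G H) : fg_map H \oe u = fg_map G.
Proof. exact/is_fgmorP/fm_dec. Qed.

Variables (R : graph) (g : gog (yo Y) R).

Lemma gog_gcone : gcone (fun e => fg_map (gog_e g e)) (fun x => fg_map (gog_n g x)).
Proof. by split=> x i h; apply: fg_map_comp. Qed.

(** The decorations map the gluing to the acyclic graph Y, and wheels along. *)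
Lemma glue_acyclic : acyclic (glue g).
Proof. by move=> n w; apply: (gr_acyclic (dcomp (glue_med gog_gcone) w)). Qed.

Definition glue_graph : graph := Graph (glue_connected g) glue_acyclic.

Definition glue_fg : Fgraph (yo Y) :=
  @FGraph (yo Y) glue_graph (@yo_mor glue_graph Y (glue_med gog_gcone)).

Lemma glue_inc_edge_dec e :
  @is_fgmor (yo Y) (gog_e g e) glue_fg (glue_inc_edge g e).
Proof. by apply/is_fgmorP; rewrite (@fg_mapK glue_graph) glue_med_inc_edge. Qed.

Lemma glue_inc_dec x : @is_fgmor (yo Y) (gog_n g x) glue_fg (glue_inc g x).
Proof. by apply/is_fgmorP; rewrite (@fg_mapK glue_graph) glue_med_inc. Qed.

Definition glue_cocone : cocone g glue_fg :=
  @Cocone _ _ g glue_fg (fun e => FGMor (@glue_inc_edge_dec e))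
    (fun x => FGMor (@glue_inc_dec x)) (glue_gcone g).1 (glue_gcone g).2.

Lemma glue_cocone_gluing : gluing (cc_e glue_cocone) (cc_n glue_cocone).
Proof. exact: glue_gluing. Qed.

(** Decorations by a graph are maps, so a map out of a gluing preserves them as
    soon as it does so on the pieces. *)
Lemma gluing_colimit (K : Fgraph (yo Y)) (c : cocone g K) :
  gluing (cc_e c) (cc_n c) -> is_colimit c.
Proof.
move=> gc Z c'; have [u [uE uN]] := gluing_ex gc (cocone_gcone c').
have ud : is_fgmor u.
  apply/is_fgmorP; apply: (gluing_epi gc) => [e|x].
  - by rewrite -ecompA uE !fg_map_comp.
  - by rewrite -ecompA uN !fg_map_comp.
exists (FGMor ud); split=> // w [wE wN]; apply: fgmor_eq.
by apply: (gluing_epi gc) => [e|x]; rewrite ?wE ?wN.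
Qed.

(** The glued graph is a colimit too, and colimits are unique. *)
Lemma colimit_gluing (K : Fgraph (yo Y)) (c : cocone g K) :
  is_colimit c -> gluing (cc_e c) (cc_n c).
Proof.
move=> cc; have g0 := glue_cocone_gluing; have c0 := gluing_colimit g0.
have [u [[uE uN] _]] := c0 _ c; have [v [[vE vN] _]] := cc _ glue_cocone.
apply: (gluing_transport g0 _ uE uN); exists v; split.
  by apply: (gluing_epi g0) => [e|x]; rewrite -ecompA ?uE ?uN ?vE ?vN ecomp_idl.
have [w [_ wU]] := cc _ c.
have idd : @is_fgmor (yo Y) K K (eid K) by move=> E a; rewrite ecomp_idl.
have uvd : @is_fgmor (yo Y) K K (u \oe v).
  by move=> E a; rewrite -ecompA (fm_dec u) (fm_dec v).
suff e : FGMor uvd = FGMor idd by exact: (congr1 (fun f : fgmor K K => fm_et f) e).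
rewrite -(wU (FGMor idd)) ?(wU (FGMor uvd)) //; split=> [e|x] /=.
- by rewrite -ecompA vE uE.
- by rewrite -ecompA vN uN.
- by rewrite ecomp_idl.
- by rewrite ecomp_idl.
Qed.

End Over.

Lemma colimit_iso (Y R : graph) (g g' : gog (yo Y) R) th (K K' : Fgraph (yo Y))
    (c : cocone g K) (c' : cocone g' K') :
  @gog_iso (yo Y) R g g' th -> gluing (cc_e c) (cc_n c) -> gluing (cc_e c') (cc_n c') ->
  exists u : etale K K', [/\ invertible u, is_fgmor u,
    forall x, u \oe cc_n c x = cc_n c' x \oe th x &
    forall e, fA u (fA (cc_e c e) (gog_edge g e)) = fA (cc_e c' e) (gog_edge g' e)].
Proof.
move=> thP gK gK'; have [u [ui uN uE]] := gluing_iso thP gK gK'.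
exists u; split=> //; apply/is_fgmorP; apply: (gluing_epi gK) => [e|x].
- apply: gog_edge_ext; rewrite fg_map_comp /= uE.
  have := gog_iso_edge thP e; rewrite /gog_edge_dec !fg_mapE.
  move=> /(congr1 (fun f : etale unit_dg Y => fA f tt)) /= ->.
  by rewrite -(fg_map_comp (cc_e c' e)).
- rewrite -ecompA uN ecompA !fg_map_comp.
  exact/is_fgmorP/(gog_iso_dec thP).
Qed.

(** * A graph is the gluing of its stars *)

Section StarGog.
Variables (X Y : graph) (y : etale X Y).

(** The Y-graph (X, y) cut into its edges and stars; this presents the free map
    of y. *)
Definition star_edge (e : edge X) : Fgraph (yo Y) :=
  @FGraph (yo Y) unit_graph (@yo_mor unit_graph Y (y \oe edge_map e)).
Definition star_node (x : node X) : Fgraph (yo Y) :=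
  @FGraph (yo Y) (star x) (@yo_mor (star x) Y (y \oe star_map x)).

Definition star_in x i (h : dg_p X i = x) : edge (star_node x) :=
  inl (exist (fun i => dg_p X i == x) i (introT eqP h)).
Definition star_out x o (h : dg_q X o = x) : edge (star_node x) :=
  inr (exist (fun o => dg_q X o == x) o (introT eqP h)).

Lemma star_in_dec x i (h : dg_p X i = x) :
  @is_fgmor (yo Y) (star_edge (dg_s X i)) (star_node x) (edge_map (star_in h)).
Proof.
move=> E a; rewrite /= ecompA -(ecompA y); congr (_ \oe _); congr (_ \oe _).
exact: unit_dom_eq.
Qed.

Lemma star_out_dec x o (h : dg_q X o = x) :
  @is_fgmor (yo Y) (star_edge (dg_t X o)) (star_node x) (edge_map (star_out h)).
Proof.
move=> E a; rewrite /= ecompA -(ecompA y); congr (_ \oe _); congr (_ \oe _).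
exact: unit_dom_eq.
Qed.

Definition star_gog : gog (yo Y) X.
Proof.
refine (@Gog (yo Y) X star_edge star_node (fun x i h => FGMor (@star_in_dec x i h))
  (fun x o h => FGMor (@star_out_dec x o h)) _ _ _ _ _).
- by move=> e; exists (eid unit_graph); apply: invertible_id.
- by move=> x i h a; apply: corolla_import.
- by move=> x i h a; apply: corolla_export.
- move=> x [i|o] bi; last by case/negP: bi; apply/codomP; exists o.
  exists (val i); split=> [|i' [h [_ [<-]]] //].
  exists (eqP (valP i)), tt; rewrite /= /star_in; congr inl; exact: val_inj.
- move=> x [i|o] bi; first by case/negP: bi; apply/codomP; exists i.
  exists (val o); split=> [|o' [h [_ [<-]]] //].
  exists (eqP (valP o)), tt; rewrite /= /star_out; congr inr; exact: val_inj.
Defined.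

Lemma star_presents : presents star_gog (free_map y).
Proof.
apply/presentsP; split=> [e|m n c]; first exact: unit_dom_eq.
have [h ch] : exists h : etale (elC m n) (star (fN c tt)), c = star_map (fN c tt) \oe h.
  exact: corolla_factor.
apply/clsP; exists h; split; first exact: corolla_etale_inv.
- by move=> E a; rewrite /= [in RHS]ch !ecompA.
- case=> k; rewrite port_fcorolla.
  + rewrite -(f_s h k); congr inl; apply: val_inj => /=.
    by rewrite [in RHS]ch.
  + rewrite -(f_t h k); congr inr; apply: val_inj => /=.
    by rewrite [in RHS]ch.
Qed.

Lemma star_gcone : gcone (g := star_gog) (@edge_map X) (@star_map X).
Proof. by split=> x i h; apply: gog_edge_ext. Qed.

Section Mediate.
Variables (Z : digraph) (zE : forall e, etale (gog_e star_gog e) Z)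
  (zN : forall x, etale (gog_n star_gog x) Z).
Hypothesis zP : gcone zE zN.

Definition star_med_edge (e : edge X) : edge Z := fA (zE e) tt.
Definition star_med_in i : iflag Z :=
  fI (zN (dg_p X i)) (exist (fun j => dg_p X j == dg_p X i) i (eqxx _)).
Definition star_med_out o : oflag Z :=
  fO (zN (dg_q X o)) (exist (fun j => dg_q X j == dg_q X o) o (eqxx _)).

Lemma star_med_s x (k : in_at x) :
  dg_s Z (fI (zN x) k) = star_med_edge (dg_s X (val k)).
Proof.
rewrite f_s; transitivity (fA (zN x) (gog_in star_gog (eqP (valP k)))).
  by congr (fA (zN x) _); congr inl; apply: val_inj.
by rewrite (gcone_in zP); congr (fA (zE _) _); exact/esym/gog_edgeP.
Qed.

Lemma star_med_t x (k : out_at x) :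
  dg_t Z (fO (zN x) k) = star_med_edge (dg_t X (val k)).
Proof.
rewrite f_t; transitivity (fA (zN x) (gog_out star_gog (eqP (valP k)))).
  by congr (fA (zN x) _); congr inr; apply: val_inj.
by rewrite (gcone_out zP); congr (fA (zE _) _); exact/esym/gog_edgeP.
Qed.

Lemma star_med_inE x (k : in_at x) : star_med_in (val k) = fI (zN x) k.
Proof. by apply: dg_s_inj; rewrite !star_med_s. Qed.

Lemma star_med_outE x (k : out_at x) : star_med_out (val k) = fO (zN x) k.
Proof. by apply: dg_t_inj; rewrite !star_med_t. Qed.

Definition star_med_dmor : dmor X Z.
Proof.
refine (@DMor X Z star_med_edge star_med_in (fun x => fN (zN x) tt) star_med_out _ _ _ _).
- by move=> i; apply: star_med_s.
- by move=> i; apply: (f_p (zN _)).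
- by move=> i; apply: (f_q (zN _)).
- by move=> i; apply: star_med_t.
Defined.

Lemma star_med_et_in :
  is_pullback (fI star_med_dmor) (dg_p X) (dg_p Z) (fN star_med_dmor).
Proof.
apply: pullback_intro => [i|i x /= e|i j /= e ex]; first exact: f_p star_med_dmor i.
  have [k <-] := corolla_fI_onto (c := zN x) e.
  by exists (val k); [exact: star_med_inE|exact/eqP/(valP k)].
move: e; rewrite (star_med_inE (exist (fun l => dg_p X l == dg_p X j) i (introT eqP ex))).
rewrite (star_med_inE (exist (fun l => dg_p X l == dg_p X j) j (eqxx _))).
by move/corolla_fI_inj => [].
Qed.

Lemma star_med_et_out :
  is_pullback (fO star_med_dmor) (dg_q X) (dg_q Z) (fN star_med_dmor).
Proof.
apply: pullback_intro => [i|i x /= e|i j /= e ex]; first exact: f_q star_med_dmor i.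
  have [k <-] := corolla_fO_onto (c := zN x) e.
  by exists (val k); [exact: star_med_outE|exact/eqP/(valP k)].
move: e; rewrite (star_med_outE (exist (fun l => dg_q X l == dg_q X j) i (introT eqP ex))).
rewrite (star_med_outE (exist (fun l => dg_q X l == dg_q X j) j (eqxx _))).
by move/corolla_fO_inj => [].
Qed.

Definition star_med : etale X Z := Etale star_med_et_in star_med_et_out.

Lemma star_med_edge_map e : star_med \oe edge_map e = zE e.
Proof. exact: unit_dom_eq. Qed.

Lemma star_med_star_map x : star_med \oe star_map x = zN x.
Proof.
apply: etale_eq => [[i|o]|[]] //=.
- by rewrite -star_med_s f_s.
- by rewrite -star_med_t f_t.
Qed.

End Mediate.

(** A map out of X is given by its values on edges, nodes and flags; the cocone
    condition says that the values at the flags of the stars fit those on edges. *)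
Lemma star_gluing : gluing (g := star_gog) (@edge_map X) (@star_map X).
Proof.
split; first exact: star_gcone.
- move=> Z zE zN zP; exists (star_med zP).
  by split=> [e|x]; [exact: star_med_edge_map|exact: star_med_star_map].
- move=> Z u u' eE eN; apply: etale_eq => [e|x].
  + exact: (congr1 (fun f : etale unit_dg _ => fA f tt) (eE e)).
  + exact: (congr1 (fun f : etale (star x) Z => fN f tt) (eN x)).
Qed.

Lemma star_edge_map_dec e :
  @is_fgmor (yo Y) (star_edge e) (@FGraph (yo Y) X (yo_mor y)) (edge_map e).
Proof. by move=> E a; rewrite /= ecompA. Qed.

Lemma star_map_dec x :
  @is_fgmor (yo Y) (star_node x) (@FGraph (yo Y) X (yo_mor y)) (star_map x).
Proof. by move=> E a; rewrite /= ecompA. Qed.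

Definition star_cocone : cocone star_gog (@FGraph (yo Y) X (yo_mor y)) :=
  @Cocone _ _ star_gog (@FGraph (yo Y) X (yo_mor y))
    (fun e => FGMor (@star_edge_map_dec e)) (fun x => FGMor (@star_map_dec x))
    star_gcone.1 star_gcone.2.

Lemma star_cocone_gluing : gluing (cc_e star_cocone) (cc_n star_cocone).
Proof. exact: star_gluing. Qed.

End StarGog.

(** * Composing with a free map is pushing forward *)

Section Glues.
Variables (Y : graph) (m n : nat) (X : mngraph (bar (yo Y)) m n) (y : etale X Y).
Hypothesis yP : fg_dec X = free_map y.

Definition free_gluing : mngraph (yo Y) m n :=
  @MNGraph (yo Y) m n (@FGraph (yo Y) X (yo_mor y)) (mn_lab X) (mn_labP X).

(** The multiplication of the monad on a graph decorated by corollas: nothing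
    changes. *)
Lemma glues_free : glues X free_gluing.
Proof.
exists (star_gog y), (star_cocone y); split=> //.
- by rewrite yP; apply: star_presents.
- exact/gluing_colimit/star_cocone_gluing.
Qed.

(** Any graph of graphs presenting the decoration is isomorphic to the one of
    stars, hence has an isomorphic gluing. *)
Lemma glues_free_uniq K : glues X K -> mn_isom free_gluing K.
Proof.
move=> [g [c [gP cP cp]]].
have := star_presents y; rewrite -yP => sP.
have [th thP] := presents_iso sP gP.
have [u [ui ud uN uE]] := colimit_iso thP (star_cocone_gluing y) (colimit_gluing cP).
by exists u; split=> // p; rewrite -(cp p (gog_edge g _)) -uE.
Qed.

End Glues.

Lemma kcomp_freeP (R S Y : graph) (r : khom R S) (v : etale S Y) (h : khom R Y) :
  kcomp r (free_map v) h <-> h = bm_comp (bar_mor (yo_mor v)) r.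
Proof.
split=> [rv|-> [|m n] a //].
- apply: bc_mor_eq => [[|m n]] a; first exact/esym/(rv elU a).
  have [X [K [eX eK XK]]] := rv (elC m n) a; rewrite eK.
  set P := rep (r (elC m n) a); pose p : etale P S := fg_map P.
  have [u [[w [wu uw]] ud up]] : mn_isom (mn_push (free_map v) P) X by apply/clsP.
  have yP : fg_dec X = free_map (v \oe p \oe w).
    apply: bc_mor_eq => E b; rewrite -[b]ecomp_idl -uw -ecompA ud.
    rewrite /= fg_mapE; congr (bar_unit_fun _).
    by rewrite /= -/p !ecompA -(ecompA _ w u) wu ecomp_idr.
  apply/esym/clsP.
  apply: mn_isom_trans (glues_free_uniq yP XK); exists u; split=> //.
    by exists w.
  move=> E b; rewrite /= fg_mapE /= -/p.
  by rewrite !ecompA -(ecompA _ w u) wu ecomp_idr.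
- set P := rep (r (elC m n) a); pose p : etale P S := fg_map P.
  have yP : fg_dec (mn_push (free_map v) P) = free_map (v \oe p).
    by apply: bc_mor_eq => E b; rewrite /= fg_mapE /= -/p ecompA.
  exists (mn_push (free_map v) P).
  exists (@free_gluing Y m n (mn_push (free_map v) P) (v \oe p)); split=> //.
    apply/clsP; exists (eid _); split=> //; first exact: invertible_id.
    by move=> E b; rewrite /= fg_mapE /= -/p ecomp_idl ecompA.
  exact: (glues_free yP).
Qed.

(** * Every section is presented by a graph of graphs *)

Lemma port_in F m n (X : mngraph F m n) k :
  port X (inl k) = val (fI (mn_lab X) k).
Proof. by rewrite /port -(f_s (mn_lab X) k). Qed.

Lemma port_out F m n (X : mngraph F m n) k :
  port X (inr k) = val (fO (mn_lab X) k).
Proof. by rewrite /port -(f_t (mn_lab X) k). Qed.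

Lemma port_relabel_in F m n m' n' (h : etale (elC m n) (elC m' n'))
  (X : mngraph F m' n') i : port (relabel h X) (inl i) = port X (inl (fI h i)).
Proof. by rewrite !port_in. Qed.

Lemma port_relabel_out F m n m' n' (h : etale (elC m n) (elC m' n'))
  (X : mngraph F m' n') o : port (relabel h X) (inr o) = port X (inr (fO h o)).
Proof. by rewrite !port_out. Qed.

Section GogOf.
Variables (F : bicoll) (R : graph) (f : sect (bar F) R).

Definition gog_of_edge (e : edge R) : Fgraph F :=
  @FGraph F unit_graph (@yoneda F elU (f elU (edge_map e))).

(** A representative is chosen at one chart of each node; the other charts differ
    by a renumbering of the flags. *)
Definition gog_of_node (x : node R) : mngraph F _ _ := rep (f (elC _ _) (chart x)).

Definition in_index x i (h : dg_p R i = x) : 'I_#|in_at x| := projT1 (cid (chart_in h)).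
Definition out_index x o (h : dg_q R o = x) : 'I_#|out_at x| := projT1 (cid (chart_out h)).

Lemma in_indexP x i (h : dg_p R i = x) : fI (chart x) (in_index h) = i.
Proof. exact: (projT2 (cid (chart_in h))). Qed.
Lemma out_indexP x o (h : dg_q R o = x) : fO (chart x) (out_index h) = o.
Proof. exact: (projT2 (cid (chart_out h))). Qed.

Definition gog_of_in x i (h : dg_p R i = x) : edge (gog_of_node x) :=
  port (gog_of_node x) (inl (in_index h)).
Definition gog_of_out x o (h : dg_q R o = x) : edge (gog_of_node x) :=
  port (gog_of_node x) (inr (out_index h)).

Lemma gog_of_port_dec x a :
  fg_dec (gog_of_node x) elU (edge_map (port (gog_of_node x) a)) =
  f elU (edge_map (fA (chart x) a)).
Proof.
pose k : etale elU (elC #|in_at x| #|out_at x|) := edge_map a.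
have := bm_nat f k (chart x); rewrite -[f _ (chart x)]repK => e.
have := etrans e (bar_act_clsU k _); rewrite /port_dec => <-.
by congr (f elU _); exact: edge_map_comp.
Qed.

Lemma edge_of_dec e (X : Fgraph F) (b : edge X) :
  fg_dec X elU (edge_map b) = f elU (edge_map e) ->
  @is_fgmor F (gog_of_edge e) X (edge_map b).
Proof.
move=> eb [|m n] a; last by case: (fN a tt).
have -> : a = eid unit_graph by apply: unit_dom_eq; case: (fA a tt).
by rewrite ecomp_idr /= bc_id.
Qed.

Lemma gog_of_in_dec x i (h : dg_p R i = x) :
  @is_fgmor F (gog_of_edge (dg_s R i)) (gog_of_node x) (edge_map (gog_of_in h)).
Proof.
apply: edge_of_dec; rewrite gog_of_port_dec.
by rewrite -(f_s (chart x) (in_index h)) in_indexP.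
Qed.

Lemma gog_of_out_dec x o (h : dg_q R o = x) :
  @is_fgmor F (gog_of_edge (dg_t R o)) (gog_of_node x) (edge_map (gog_of_out h)).
Proof.
apply: edge_of_dec; rewrite gog_of_port_dec.
by rewrite -(f_t (chart x) (out_index h)) out_indexP.
Qed.

Lemma unit_eq (x y : unit) : x = y. Proof. by case: x; case: y. Qed.

Definition gog_of : gog F R.
Proof.
refine (@Gog F R gog_of_edge gog_of_node (fun x i h => FGMor (@gog_of_in_dec x i h))
  (fun x o h => FGMor (@gog_of_out_dec x o h)) _ _ _ _ _).
- by move=> e; exists (eid unit_graph); apply: invertible_id.
- by move=> x i h a /=; rewrite /gog_of_in port_in; apply: valP.
- by move=> x o h a /=; rewrite /gog_of_out port_out; apply: valP.
- move=> x b bi.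
  have [k ek] := corolla_fI_onto (c := mn_lab (gog_of_node x))
    (i' := exist _ b bi : imports _) (unit_eq _ _).
  have ex : dg_p R (fI (chart x) k) = x by rewrite f_p.
  exists (fI (chart x) k); split.
    exists ex, tt; rewrite /= /gog_of_in.
    have -> : in_index ex = k by apply: (corolla_fI_inj (c := chart x)); apply: in_indexP.
    by rewrite port_in ek.
  move=> i [h [_ /=]]; rewrite /gog_of_in port_in => eb.
  rewrite -(in_indexP h); congr (fI (chart x) _).
  by apply: (corolla_fI_inj (c := mn_lab (gog_of_node x))); apply: val_inj; rewrite eb ek.
- move=> x b bi.
  have [k ek] := corolla_fO_onto (c := mn_lab (gog_of_node x))
    (o' := exist _ b bi : exports _) (unit_eq _ _).
  have ex : dg_q R (fO (chart x) k) = x by rewrite f_q.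
  exists (fO (chart x) k); split.
    exists ex, tt; rewrite /= /gog_of_out.
    have -> : out_index ex = k by apply: (corolla_fO_inj (c := chart x)); apply: out_indexP.
    by rewrite port_out ek.
  move=> i [h [_ /=]]; rewrite /gog_of_out port_out => eb.
  rewrite -(out_indexP h); congr (fO (chart x) _).
  by apply: (corolla_fO_inj (c := mn_lab (gog_of_node x))); apply: val_inj; rewrite eb ek.
Defined.

Lemma gog_of_presents : presents gog_of f.
Proof.
apply/presentsP; split=> [e|m n c].
  rewrite /gog_edge_dec /=.
  have -> : edge_map (gog_edge gog_of e) = eid unit_graph.
    by apply: unit_dom_eq; apply: unit_eq.
  by rewrite bc_id.
have [h ch] := corolla_chart (erefl (fN c tt)).
have -> : f (elC m n) c = cls (relabel h (gog_of_node (fN c tt))).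
  rewrite [in LHS]ch; apply: etrans (bm_nat f (E := elC m n) (E' := elC _ _) h _) _.
  by rewrite -[f _ (chart _)]repK; apply: bar_act_clsC.
apply/clsP; exists (eid _); split=> [||[i|o]]; first exact: invertible_id.
- by move=> E a; rewrite ecomp_idl.
- rewrite [RHS]/port /= /gog_in /= /gog_of_in.
  have -> : in_index (etrans (f_p c i) erefl) = fI h i.
    by apply: (corolla_fI_inj (c := chart (fN c tt))); rewrite in_indexP [in LHS]ch.
  exact: port_relabel_in.
- rewrite [RHS]/port /= /gog_out /= /gog_of_out.
  have -> : out_index (etrans (f_q c o) erefl) = fO h o.
    by apply: (corolla_fO_inj (c := chart (fN c tt))); rewrite out_indexP [in LHS]ch.
  exact: port_relabel_out.
Qed.

End GogOf.

(** * Changing the decorations of a graph of graphs *)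

Section Push.
Variables (F F' : bicoll) (f : bc_mor F F').

Lemma fgmor_push_dec (G H : Fgraph F) (u : fgmor G H) :
  @is_fgmor F' (fg_push f G) (fg_push f H) u.
Proof. by move=> E a; rewrite /= (fm_dec u). Qed.

Definition fgmor_push (G H : Fgraph F) (u : fgmor G H) :
  fgmor (fg_push f G) (fg_push f H) := FGMor (fgmor_push_dec u).

Variables (R : graph) (g : gog F R).

Definition gog_push : gog F' R :=
  @Gog F' R (fun e => fg_push f (gog_e g e)) (fun x => fg_push f (gog_n g x))
    (fun x i h => fgmor_push (gog_i g h)) (fun x o h => fgmor_push (gog_o g h))
    (gog_unit g) (@gog_import _ _ g) (@gog_export _ _ g)
    (@gog_res_in _ _ g) (@gog_res_out _ _ g).

Lemma gog_push_presents d : presents g d -> presents gog_push (bm_comp (bar_mor f) d).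
Proof.
move=> /presentsP [dU dC]; apply/presentsP; split=> [e|m n c].
- exact: (congr1 (f elU) (dU e)).
- rewrite [LHS]/= [d _ _]dC; apply: etrans (bar_fun_cls f _) _; apply/clsP.
  exists (eid _); split=> [||[i|o]] //; first exact: invertible_id.
  by move=> E a; rewrite ecomp_idl.
Qed.

Definition cocone_push (K : Fgraph F) (c : cocone g K) : cocone gog_push (fg_push f K) :=
  @Cocone _ _ gog_push (fg_push f K) (fun e => fgmor_push (cc_e c e))
    (fun x => fgmor_push (cc_n c x)) (@cc_i _ _ _ _ c) (@cc_o _ _ _ _ c).

Lemma gluing_push (K : Fgraph F) (c : cocone g K) :
  gluing (cc_e c) (cc_n c) -> gluing (cc_e (cocone_push c)) (cc_n (cocone_push c)).
Proof. by case=> cone ex epi; split; [exact: cone|exact: ex|exact: epi]. Qed.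

End Push.

Section OverGluing.
Variables (F : bicoll) (R : graph) (g : gog F R) (Q : graph).
Variables (zE : forall e, etale (gog_e g e) Q) (zN : forall x, etale (gog_n g x) Q).
Hypothesis zP : gcone zE zN.

Definition over_edge e : Fgraph (yo Q) := @FGraph (yo Q) (gog_e g e) (yo_mor (zE e)).
Definition over_node x : Fgraph (yo Q) := @FGraph (yo Q) (gog_n g x) (yo_mor (zN x)).

Lemma over_in_dec x i (h : dg_p R i = x) :
  @is_fgmor (yo Q) (over_edge (dg_s R i)) (over_node x) (gog_i g h).
Proof. by move=> E a; rewrite /= ecompA zP.1. Qed.

Lemma over_out_dec x o (h : dg_q R o = x) :
  @is_fgmor (yo Q) (over_edge (dg_t R o)) (over_node x) (gog_o g h).
Proof. by move=> E a; rewrite /= ecompA zP.2. Qed.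

(** Replacing the decorations by the legs of a cocone to Q.  If the cocone is a
    gluing, the new graph of graphs presents a refinement R -> Q. *)
Definition gog_over : gog (yo Q) R :=
  @Gog (yo Q) R over_edge over_node (fun x i h => FGMor (@over_in_dec x i h))
    (fun x o h => FGMor (@over_out_dec x o h))
    (gog_unit g) (@gog_import _ _ g) (@gog_export _ _ g)
    (@gog_res_in _ _ g) (@gog_res_out _ _ g).

Definition over_vertex : Fgraph (yo Q) := @FGraph (yo Q) Q (yo_mor (eid Q)).

Lemma over_edge_dec e : @is_fgmor (yo Q) (over_edge e) over_vertex (zE e).
Proof. by move=> E a; rewrite /= ecomp_idl. Qed.
Lemma over_node_dec x : @is_fgmor (yo Q) (over_node x) over_vertex (zN x).
Proof. by move=> E a; rewrite /= ecomp_idl. Qed.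

Definition over_cocone : cocone gog_over over_vertex :=
  @Cocone _ _ gog_over over_vertex (fun e => FGMor (@over_edge_dec e))
    (fun x => FGMor (@over_node_dec x)) zP.1 zP.2.

Lemma over_gluing : gluing zE zN -> gluing (cc_e over_cocone) (cc_n over_cocone).
Proof. by case=> cone ex epi; split; [exact: cone|exact: ex|exact: epi]. Qed.

Lemma over_refinement : gluing zE zN -> refinement (gog_sect gog_over).
Proof.
move=> zG; exists gog_over, over_vertex, over_cocone, (eid Q); split=> //.
- exact: gog_sectP.
- exact/gluing_colimit/over_gluing.
- exact: invertible_id.
Qed.

End OverGluing.

(** * Factorisations *)

Lemma free_map_comp (X Y Z : graph) (u : etale X Y) (v : etale Y Z) :
  bm_comp (bar_mor (yo_mor v)) (free_map u) = free_map (v \oe u).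
Proof.
apply: bc_mor_eq => [[|m n]] c; first exact: ecompA.
apply: etrans (bar_fun_cls _ _) _; apply/clsP; exists (eid _); split=> //.
  exact: invertible_id.
by move=> E a; rewrite /= ecomp_idl !ecompA.
Qed.

Lemma free_map_inj (X Y : graph) (u v : etale X Y) :
  free_map u = free_map v -> fA u =1 fA v.
Proof.
move=> e a.
exact: (congr1 (fun f : khom X Y => fA (f elU (edge_map a) : etale unit_dg Y) tt) e).
Qed.

Lemma factorisation_freeP (R Y Q : graph) (f : khom R Y) (r : khom R Q) (v : etale Q Y) :
  refinement r -> f = bm_comp (bar_mor (yo_mor v)) r -> factorisation f r (free_map v).
Proof. by move=> rr fE; split=> //; [exists v|apply/kcomp_freeP]. Qed.

(** Glue a presentation of f; the decorations of its pieces by Y are the legs of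
    the gluing followed by the map to Y. *)
Lemma factorisation_exists (R Y : graph) (f : khom R Y) :
  exists (Q : graph) (r : khom R Q) (m : khom Q Y), factorisation f r m.
Proof.
pose g := gog_of f; pose c := glue_cocone g; pose v := fg_map (glue_fg g).
have cP := cocone_gcone c; pose gQ := gog_over cP.
exists (glue_fg g), (gog_sect gQ), (free_map v); apply: factorisation_freeP.
  exact/over_refinement/glue_cocone_gluing.
have thP : @gog_iso _ _ g (gog_push (yo_mor v) gQ) (fun x => eid _).
  split=> // [x|x|e].
  - exact: invertible_id.
  - move=> E a; rewrite [in RHS]fg_mapE -(fg_map_comp (cc_n c x)) /=.
    by rewrite ecomp_idl !ecompA.
  - by rewrite /gog_edge_dec fg_mapE /= -(fg_map_comp (cc_e c e)) ecompA.
apply: iso_presents thP (gog_of_presents f) _.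
exact/gog_push_presents/gog_sectP.
Qed.

(** The given gluings K and K' over Q and Q' stay gluings over Y, where they glue
    presentations of the same f.  The isomorphism K -> K' found there is carried to
    Q -> Q' by the invertible maps w and w'. *)
Lemma factorisation_unique (R Y : graph) (f : khom R Y)
    (Q : graph) (r : khom R Q) (m : khom Q Y)
    (Q' : graph) (r' : khom R Q') (m' : khom Q' Y) :
  factorisation f r m -> factorisation f r' m' ->
  exists i : khom Q Q', compatible_free_iso r m r' m' i.
Proof.
move=> [[g [K [c [w [gr /colimit_gluing gK dK wi]]]]] [v ->] /kcomp_freeP fE].
move=> [[g' [K' [c' [w' [gr' /colimit_gluing gK' dK' wi']]]]] [v' ->] /kcomp_freeP fE'].
have {dK} wE : fg_dec K = yo_mor w by apply: bc_mor_eq => E a; apply: dK.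
have {dK'} wE' : fg_dec K' = yo_mor w' by apply: bc_mor_eq => E a; apply: dK'.
have [th thP] : exists th, @gog_iso _ _ (gog_push (yo_mor v) g) (gog_push (yo_mor v') g') th.
  by apply: (presents_iso (d := f)); [rewrite fE|rewrite fE']; apply: gog_push_presents.
have [u [ui ud uN uE]] := colimit_iso thP (gluing_push (yo_mor v) gK)
  (gluing_push (yo_mor v') gK').
have [w1 [w1w ww1]] := wi; pose t := w' \oe u \oe w1.
have tw : t \oe w = w' \oe u by rewrite -ecompA w1w ecomp_idr.
have vt : v' \oe t = v.
  have vw : v' \oe (w' \oe u) = v \oe w.
    apply: yo_mor_inj; apply: bc_mor_eq => E a; have := ud E a.
    by rewrite /= wE wE' /= !ecompA.
  by rewrite !ecompA -(ecompA v' w') vw -ecompA ww1 ecomp_idr.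
exists (free_map t); split.
- exists t; split=> //; apply: invertible_comp; last by exists w.
  exact: invertible_comp.
- apply/kcomp_freeP; apply/esym.
  have thP' : @gog_iso _ _ (gog_push (yo_mor t) g) g' th.
    case: thP => ti td tin tout te; split=> // [x E a|e].
    + rewrite fg_mapE /= fg_mapE /= -(fg_map_comp (cc_n c x)) -(fg_map_comp (cc_n c' x)).
      have -> : fg_map K = w by apply: yo_mor_inj; rewrite -fg_mapE.
      have -> : fg_map K' = w' by apply: yo_mor_inj; rewrite -fg_mapE.
      rewrite !ecompA tw -(ecompA w' u).
      by rewrite (uN x) !ecompA.
    + rewrite /gog_edge_dec /= fg_mapE fg_mapE /=.
      rewrite -(fg_map_comp (cc_e c e)) -(fg_map_comp (cc_e c' e)).
      have -> : fg_map K = w by apply: yo_mor_inj; rewrite -fg_mapE.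
      have -> : fg_map K' = w' by apply: yo_mor_inj; rewrite -fg_mapE.
      rewrite !ecompA tw; apply: unit_dom_eq => /=; congr (fA w' _).
      exact: uE.
  apply: iso_presents thP' (gog_push_presents _ gr) gr'.
- by apply/kcomp_freeP; rewrite free_map_comp vt.
Qed.

(** * Zigzag graphs and their deck transformations *)

Section Zigzag.
Variables (T : finType) (tau : T -> T).

(** Nodes and edges are both indexed by two copies of T.  The sources (false, k)
    and sinks (true, k) alternate: edges (false, k) and (true, k) leave the source
    k for the sinks k and tau k.  Every edge has both flags, so the only data are
    its two ends. *)
Definition zigzag_end (a : bool * T) : bool * T := (true, if a.1 then tau a.2 else a.2).
Definition zigzag_start (a : bool * T) : bool * T := (false, a.2).

Definition zigzag_dg : digraph :=
  @Digraph (bool * T)%type (bool * T)%type (bool * T)%type (bool * T)%type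
    id zigzag_end zigzag_start id (@inj_id _) (@inj_id _).

(** A node on a wheel would be the end of an edge and the start of another. *)
Lemma zigzag_acyclic : acyclic zigzag_dg.
Proof.
move=> n w; have := f_q w ord0; have := f_p w ord0 => /= <-.
by [].
Qed.

Lemma zigzag_no_import (a : edge zigzag_dg) : ~~ is_import a.
Proof. by rewrite negbK; apply/codomP; exists a. Qed.

Lemma zigzag_no_export (a : edge zigzag_dg) : ~~ is_export a.
Proof. by rewrite negbK; apply/codomP; exists a. Qed.

Hypothesis orbit : forall k l, exists n, l = iter n tau k.

(** From the sink k one edge leads back to the source k, whose other edge leads to
    the sink tau k; so the sinks in an orbit of tau are connected. *)
Lemma zigzag_connected (k0 : T) : connected zigzag_dg.
Proof.
apply: colouring_connected; first by constructor; left; exact: (true, k0).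
move=> cA cN [cI cO]; exists (cN (true, k0)).
have start_end k : cN (false, k) = cN (true, k).
  exact: etrans (esym (cO (false, k))) (cI (false, k)).
have step k : cN (true, tau k) = cN (true, k).
  exact: etrans (etrans (esym (cI (true, k))) (cO (true, k))) (start_end k).
have const k : cN (true, k) = cN (true, k0).
  by have [n ->] := orbit k0 k; elim: n => //= n IH; rewrite step.
split=> [[b k]|[[] k]] //; last by rewrite start_end.
by have /= -> := cO (b, k); rewrite start_end.
Qed.

End Zigzag.

Section ZigzagMap.
Variables (T T' : finType) (tau : T -> T) (tau' : T' -> T') (f : T -> T').
Hypotheses (tau_inj : injective tau) (f_tau : forall k, f (tau k) = tau' (f k)).
Hypothesis tau_onto : forall k, exists l, tau l = k.
Hypothesis tau'_inj : injective tau'.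

Let zigzag_fun (a : bool * T) : bool * T' := (a.1, f a.2).

(** An equivariant map of index sets need not be injective: the flags at a node
    are in bijection with those at its image in any case. *)
Definition zigzag_dmor : dmor (zigzag_dg tau) (zigzag_dg tau').
Proof.
refine (@DMor (zigzag_dg tau) (zigzag_dg tau')
  zigzag_fun zigzag_fun zigzag_fun zigzag_fun _ _ _ _) => // - [[] k] //.
by rewrite /= /zigzag_end /= -f_tau.
Defined.

Lemma zigzag_et_in : is_pullback (fI zigzag_dmor) (dg_p (zigzag_dg tau))
  (dg_p (zigzag_dg tau')) (fN zigzag_dmor).
Proof.
apply: pullback_intro => [i|[b l] [b' k] [<- /=]|[b k] [b' l] [<- _] [/=]].
- exact: f_p zigzag_dmor i.
- case: b => /= e; last by exists (false, k) => //; rewrite /= /zigzag_fun /= e.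
  have [j ej] := tau_onto k; exists (true, j); rewrite /= /zigzag_end /= ?ej //.
  by rewrite /zigzag_fun /=; congr pair; apply: tau'_inj; rewrite -f_tau ej.
- by case: (b) => [/tau_inj ->|->].
Qed.

Lemma zigzag_et_out : is_pullback (fO zigzag_dmor) (dg_q (zigzag_dg tau))
  (dg_q (zigzag_dg tau')) (fN zigzag_dmor).
Proof.
apply: pullback_intro => [//|[b l] [b' k] [<- /= e]|[b k] [b' l] [<- _] [/= ->] //].
by exists (b, k); rewrite /= /zigzag_fun ?e.
Qed.

Definition zigzag_map : etale (zigzag_dg tau) (zigzag_dg tau') :=
  Etale zigzag_et_in zigzag_et_out.

End ZigzagMap.

Lemma unit_orbit (k l : unit) : exists n, l = iter n id k.
Proof. by exists 0; case: k; case: l. Qed.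

Lemma negb_orbit (k l : bool) : exists n, l = iter n negb k.
Proof. by case: k; case: l; try (by exists 0); exists 1. Qed.

Definition parallel_pair : graph :=
  Graph (zigzag_connected unit_orbit tt) (@zigzag_acyclic unit id).
Definition four_cycle : graph :=
  Graph (zigzag_connected negb_orbit true) (@zigzag_acyclic bool negb).

Lemma negb_onto k : exists l, ~~ l = k.
Proof. by exists (~~ k); rewrite negbK. Qed.

(** The double cover of the pair of parallel edges and its non-trivial deck
    transformation. *)
Definition cover : etale four_cycle parallel_pair :=
  zigzag_map (f := fun=> tt) negb_inj (fun=> erefl) negb_onto (@inj_id unit).
Definition deck : etale four_cycle four_cycle :=
  zigzag_map (f := negb) negb_inj (fun=> erefl) negb_onto negb_inj.

Lemma deckK : deck \oe deck = eid four_cycle.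
Proof. by apply: etale_eq => - [b k]; rewrite /= negbK. Qed.

Lemma cover_deck : cover \oe deck = cover.
Proof. exact: etale_eq. Qed.

(** * Refining an isolated node into a graph without ports *)

Section Portless.
Variable Q : graph.
Hypotheses (no_import : forall a : edge Q, ~~ is_import a)
  (no_export : forall a : edge Q, ~~ is_export a).

Let N : graph := elC 0 0.
Let Qid : Fgraph (yo Q) := @FGraph (yo Q) Q (yo_mor (eid Q)).

Lemma ord0_empty : 'I_0 -> False.
Proof. by case. Qed.

Lemma isolated_edge (e : edge N) : False.
Proof. by case: e => - []. Qed.

(** The isolated node has no flags, so there is nothing to identify: the gluing is
    the graph Q placed at the node. *)
Definition portless_gog : gog (yo Q) N.
Proof.
refine (@Gog (yo Q) N (fun=> Qid) (fun=> Qid) (fun x i _ => False_rect _ (ord0_empty i))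
  (fun x o _ => False_rect _ (ord0_empty o)) _ _ _ _ _).
- by move=> e; case: (isolated_edge e).
- by move=> x [].
- by move=> x [].
- by move=> x b; rewrite (negPf (no_import b)).
- by move=> x b; rewrite (negPf (no_export b)).
Defined.

Lemma portless_gcone : gcone (g := portless_gog) (fun=> eid Q) (fun=> eid Q).
Proof. by split=> x []. Qed.

Lemma Qid_dec : @is_fgmor (yo Q) Qid Qid (eid Q).
Proof. by move=> E a; rewrite ecomp_idl. Qed.

Definition portless_cocone : cocone portless_gog Qid :=
  @Cocone _ _ portless_gog Qid (fun=> FGMor Qid_dec) (fun=> FGMor Qid_dec)
    portless_gcone.1 portless_gcone.2.

Definition portless_khom : khom N Q := gog_sect portless_gog.

Lemma portless_refinement : refinement portless_khom.
Proof.
exists portless_gog, Qid, portless_cocone, (eid Q); split=> //.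
- exact: gog_sectP.
- apply: gluing_colimit; split; first exact: portless_gcone.
  + move=> Z zE zN _; exists (zN tt); split=> [e|[]]; first by case: (isolated_edge e).
    by rewrite ecomp_idr.
  + by move=> Z u u' _ /(_ tt); rewrite !ecomp_idr.
- exact: invertible_id.
Qed.

(** Without ports, an automorphism only has to preserve decorations to identify
    two graphs; so moving the decoration by s gives an isomorphic graph. *)
Lemma portless_automorphism (s : etale Q Q) : invertible s ->
  bm_comp (bar_mor (yo_mor s)) portless_khom = portless_khom.
Proof.
move=> si; have thP : @gog_iso _ _ (gog_push (yo_mor s) portless_gog) portless_gog (fun=> s).
  split=> [x|x E a|x []|x []|e]; [exact: si|by rewrite /= !ecomp_idl|by []|by []|].
  by case: (isolated_edge e).
apply: iso_presents thP _ (gog_sectP _).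
exact/gog_push_presents/gog_sectP.
Qed.

End Portless.

Lemma factorisation_not_rigid :
  exists (R Y : graph) (f : khom R Y)
     (Q : graph) (r : khom R Q) (m : khom Q Y)
     (Q' : graph) (r' : khom R Q') (m' : khom Q' Y) (i j : khom Q Q'),
     [/\ factorisation f r m, factorisation f r' m',
         compatible_free_iso r m r' m' i, compatible_free_iso r m r' m' j &
         i <> j].
Proof.
pose r := @portless_khom four_cycle (@zigzag_no_import bool negb) (@zigzag_no_export bool negb).
pose m := free_map cover.
have rm : factorisation (bm_comp (bar_mor (yo_mor cover)) r) r m.
  by apply: factorisation_freeP => //; apply: portless_refinement.
have aut s : invertible s -> cover \oe s = cover ->
    compatible_free_iso r m r m (free_map s).
  move=> si cs; split; first by exists s.
  - by apply/kcomp_freeP; rewrite portless_automorphism.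
  - by apply/kcomp_freeP; rewrite free_map_comp cs.
exists (elC 0 0), parallel_pair, (bm_comp (bar_mor (yo_mor cover)) r).
exists four_cycle, r, m, four_cycle, r, m, (free_map (eid four_cycle)), (free_map deck).
split=> //; first by apply: aut; [exact: invertible_id|exact: ecomp_idr].
- by apply: aut; [exists deck; rewrite deckK|exact: cover_deck].
- by move=> /free_map_inj /(_ (true, true)).
Qed.

(* The last conjunct is the non-uniqueness of the comparison isomorphism. *)
Theorem proposition2p3p4 :
  (forall (R Y : graph) (f : khom R Y),
     exists (Q : graph) (r : khom R Q) (m : khom Q Y), factorisation f r m) /\
  (forall (R Y : graph) (f : khom R Y)
     (Q : graph) (r : khom R Q) (m : khom Q Y)
     (Q' : graph) (r' : khom R Q') (m' : khom Q' Y),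
     factorisation f r m -> factorisation f r' m' ->
     exists i : khom Q Q', compatible_free_iso r m r' m' i) /\
  (exists (R Y : graph) (f : khom R Y)
     (Q : graph) (r : khom R Q) (m : khom Q Y)
     (Q' : graph) (r' : khom R Q') (m' : khom Q' Y) (i j : khom Q Q'),
     [/\ factorisation f r m, factorisation f r' m',
         compatible_free_iso r m r' m' i, compatible_free_iso r m r' m' j &
         i <> j]).
Proof.
split; first exact: factorisation_exists.
split; first exact: factorisation_unique.
exact: factorisation_not_rigid.
Qed.
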